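(* Let $u>0$ and the initial point $x\ge 0$ be fixed. Consider the state process $X_x^u$ and the stationary process $X_u^*$ described in the context, both defined on the same probability space. Then the following results hold: (i) There is a finite stopping time $\tau_0$ such that $X_x^u(t)=X_u^*(t)$ for all $t\ge\tau_0$. Furthermore, $E(\tau_0^\beta)<\infty$ for all $\beta\ge 0$. (ii) The cost functional $I(u,x)=h(u)+\limsup_{T\to\infty}\frac1T E\bigl(\int_0^T C(X_x^u(t))\,dt+p\,L_x^u(T)\bigr)$ is finite and independent of $x$, that is, $I(u,x)=I(u,0)<\infty$ for $x\ge 0$. Consequently, the value function $V_0(x)=\inf_{u>0}I(u,x)$ is also finite and independent of $x$, that is, $V_0(x)=V_0(0)<\infty$ for $x\ge 0$.
   Context: Let $H\in[\tfrac12,1)$ and let $W_H=(W_H(t))_{t\ge 0}$ be a fractional Brownian motion with Hurst parameter $H$: a continuous zero-mean Gaussian process with stationary increments, $W_H(0)=0$ and $\mathrm{Cov}(W_H(s),W_H(t))=\frac12\bigl[t^{2H}+s^{2H}-|t-s|^{2H}\bigr]$ for $s,t\ge 0$. For $x\ge 0$ and $u\ge 0$ define, for $t\ge 0$, $$L_x^u(t)=-\min\Bigl\{0,\min_{s\in[0,t]}\bigl(x-us+W_H(s)\bigr)\Bigr\},\qquad X_x^u(t)=x-ut+W_H(t)+L_x^u(t).$$ For $u>0$ put $Z_u=\max_{s\ge 0}\{W_H(s)-us\}$. It is a known fact that there is a probability space supporting the processes $X_x^u$, $L_x^u$ (for any $x\ge 0$) and a stationary process $X_u^*=(X_u^*(t))_{t\ge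 0}$ such that $X_u^*(t)=W_H(t)-ut+\max\{X_u^*(0),L_0^u(t)\}$ for $t\ge 0$ and $X_u^*(t)$ has the same distribution as $Z_u$ for every $t\ge 0$; this probability space is used. Standing assumptions: $p\ge 0$ is a constant; $h:[0,\infty)\to[0,\infty)$ is continuous, non-decreasing, with $\lim_{u\to\infty}h(u)=+\infty$; $C:[0,\infty)\to[0,\infty)$ is continuous, non-decreasing, and satisfies $0\le C(y)\le K(1+y^\gamma)$ for all $y\ge0$, for some constants $K>0$, $\gamma>0$. *)

(* Defs.v *)
From HB Require Import structures.
From mathcomp Require Import all_boot all_order all_algebra.
From mathcomp Require Import all_classical all_reals all_analysis.
From mathcomp Require Import measurable_realfun.

Set Implicit Arguments.
Unset Strict Implicit.
Unset Printing Implicit Defensive.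

Import Order.TTheory GRing.Theory Num.Theory.
Import numFieldNormedType.Exports.

Local Open Scope classical_set_scope.
Local Open Scope ring_scope.

(* Processes are indexed by R, but only their values at times t >= 0 are ever
   constrained or used. *)

Section processes.
Context {d : measure_display} {T : measurableType d} {R : realType}.
Variable P : probability T R.
Implicit Types X Y : R -> T -> R.

Definition same_law d' (T' : measurableType d') (f g : T -> T') :=
  forall A : set T', measurable A -> P (f @^-1` A) = P (g @^-1` A).

Definition same_fdd X Y :=
  forall (n : nat) (t : 'I_n -> R), (forall i, 0 <= t i) ->
  @same_law _ (n.-tuple R) (fun w => [tuple X (t i) w | i < n])
                           (fun w => [tuple Y (t i) w | i < n]).

Definition stationary_process X :=
  forall s : R, 0 <= s -> same_fdd (fun t => X (t + s)) X.

Definition stationary_increments X :=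
  forall s : R, 0 <= s ->
  same_fdd (fun t w => X (t + s) w - X s w) (fun t w => X t w - X 0 w).

(* The library's [normal_prob m 0] is not the point mass at [m] (it is the
   uniform law on [0, 1]), so the degenerate case is treated separately. *)
Definition gaussian_law (m s : R) (A : set R) : \bar R :=
  if s == 0 then \d_m A else normal_prob m s A.

Definition gaussian_variable (f : T -> R) :=
  exists m s : R, 0 <= s /\
    forall A : set R, measurable A -> P (f @^-1` A) = gaussian_law m s A.

Definition gaussian_process X :=
  forall (n : nat) (t a : 'I_n -> R), (forall i, 0 <= t i) ->
  gaussian_variable (fun w => \sum_(i < n) a i * X (t i) w).

Record fractional_brownian_motion (H : R) (W : R -> {RV P >-> R}) : Prop := {
  fbm_continuous : forall w : T, {within `[0, +oo[, continuous (W ^~ w)} ;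
  fbm_start : forall w : T, W 0 w = 0 ;
  fbm_gaussian : gaussian_process W ;
  fbm_centered : forall t : R, 0 <= t -> ('E_P[W t] = 0)%E ;
  fbm_increments : stationary_increments W ;
  fbm_covariance : forall s t : R, 0 <= s -> 0 <= t ->
    covariance P (W s) (W t) =
      (2^-1 * (t `^ (2 * H) + s `^ (2 * H) - `|t - s| `^ (2 * H)))%:E }.

Definition generated_filtration X Y (t : R) : set (set T) :=
  <<s \bigcup_(s in `[0, t])
        (preimage_set_system setT (X s) measurable `|`
         preimage_set_system setT (Y s) measurable) >>.

Definition stopping_time (F : R -> set (set T)) (tau : T -> \bar R) :=
  (forall w, (0 <= tau w)%E) /\
  forall t : R, 0 <= t -> F t [set w | (tau w <= t%:E)%E].

(* Paths of W are continuous, so the [inf] over the compact interval [0, t]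
   is a minimum. *)
Definition regulator (W : R -> T -> R) (x u t : R) (w : T) : R :=
  - Num.min 0 (inf [set x - u * s + W s w | s in `[0, t]]).

Definition state (W : R -> T -> R) (x u t : R) (w : T) : R :=
  x - u * t + W t w + regulator W x u t w.

(* The maximum of W(s) - us over s >= 0 is only almost surely finite: where
   the path of W(s) - us is unbounded above, this is +oo. *)
Definition all_time_max (W : R -> T -> R) (u : R) (w : T) : \bar R :=
  ereal_sup [set (W s w - u * s)%:E | s in `[0, +oo[].

Definition cost (W : R -> T -> R) (h C : R -> R) (p u x : R) : \bar R :=
  ((h u)%:E +
   limf_esup (fun S : R => (S^-1)%:E *
     \int[P]_w ((\int[lebesgue_measure]_(t in `[0%R, S]) (C (state W x u t w))%:E)
                + (p * regulator W x u S w)%:E))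
     (+oo%R : set_system R))%E.

Definition value (W : R -> T -> R) (h C : R -> R) (p x : R) : \bar R :=
  ereal_inf [set cost W h C p u x | u in `]0, +oo[].

End processes.

(* Main.v *)
Require Import Defs.
From HB Require Import structures.
From mathcomp Require Import all_boot all_order all_algebra.
From mathcomp Require Import all_classical all_reals all_analysis.
From mathcomp Require Import measurable_realfun.
From mathcomp Require Import ring lra zify.

Set Implicit Arguments.
Unset Strict Implicit.
Unset Printing Implicit Defensive.

Import Order.TTheory GRing.Theory Num.Theory.
Import numFieldNormedType.Exports.

Local Open Scope classical_set_scope.
Local Open Scope ring_scope.

(** Write L for the regulator started from 0.  Two processes reflected along
the same path differ only through their starting points: from x the state is
W(t) - ut + max(x, L(t)) ([stateE]), and the stationary process has the same
form with X*(0) in place of x.  Hence they agree from the first moment at which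
L(t) >= max(x, X*(0)).  As L(t) >= ut - W(t), disagreement at an integer time n
forces un - W(n) < max(x, X*(0)).  The standard deviation n^H of W(n) is
negligible before un because H < 1, so the probability of disagreement at time
n decreases faster than every power of n ([uncoupled_probability_le]) as soon
as X*(0) has tails smaller than every power.  The coupling time is taken to be
the first integer at which the two processes agree; its moments are then
dominated by convergent sums over n ([coupling_time_moment]).

The analytic core is a bound on every moment of the state, uniform in time
([expectation_state_bound_le]).  The state at time t is at most
x + sup over s <= t of W(t) - W(s) - u(t - s).  Cutting time into unit
intervals leaves two tasks.  Inside an interval the oscillation of W is
controlled by chaining over dyadic points ([oscillation_le_chain_sum]), which
uses the even moments of Gaussian increments ([gaussian_even_moment]).  Across
a gap of i intervals, the inequality (a - b)_+^q <= a^(q+r) / b^r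
([expr_excess_le]) bounds the q-th power of the excess of an increment over the
drift; taking r large makes the expectation of order i^(-2), and the supremum
is bounded by the sum over i.

The tail of X*(0) comes from the same moments ([stationary_rapid_tail]): by
stationarity X*(0) has the law of X*(n), and X*(n) is the state started from 0
except on an event whose probability tends to 0 with 1/n.

For the cost, the states started from x and from 0 coincide once they are
coupled, and their regulators differ by at most x.  The difference of the two
expected costs over [0, S] is therefore at most the expected cost accumulated
over uncoupled unit intervals, plus px; this is bounded independently of S
([expected_running_cost_le0]) and disappears after division by S.  Finiteness
follows from the uniform moments ([expected_running_cost_linear]).

The state involves an infimum over a continuum of times.  All estimates compare
lower integrals with explicit measurable majorants built from countably many
values of W ([ge0_le_lower_integral], [lower_integralD_le]), so that the
measurability of the state as a random function never has to be discussed. *)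

(** * Lower integrals and densities *)

Section lower_integral.
Context {d : measure_display} {T : measurableType d} {R : realType}.
Variable mu : {measure set T -> \bar R}.
Import HBNNSimple.
Local Open Scope ereal_scope.

(** The integral of a nonnegative function is a supremum over the simple
functions below it, hence monotone among all functions. *)
Lemma ge0_le_lower_integral (D : set T) (f g : T -> \bar R) :
  (forall x, D x -> 0 <= f x) -> (forall x, D x -> f x <= g x) ->
  \int[mu]_(x in D) f x <= \int[mu]_(x in D) g x.
Proof.
move=> f0 fg; have g0 x : D x -> 0 <= g x.
  by move=> Dx; apply: le_trans (f0 _ Dx) (fg _ Dx).
rewrite !ge0_integralE//; apply: ereal_sup_le => _ [/= h hf <-].
exists h => // x; apply: le_trans (hf x) _.
by rewrite !patchE; case: ifPn => // /set_mem /fg.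
Qed.

Lemma ge0_le_lower_integralT (f g : T -> \bar R) :
  (forall x, 0 <= f x) -> (forall x, f x <= g x) ->
  \int[mu]_x f x <= \int[mu]_x g x.
Proof. by move=> f0 fg; apply: ge0_le_lower_integral. Qed.

(** If a simple function h lies below f + g, then the positive part of h - g
is measurable and lies below f. *)
Lemma lower_integralD_le (D : set T) (f g : T -> \bar R) : measurable D ->
  (forall x, D x -> 0 <= f x) -> (forall x, D x -> 0 <= g x) ->
  measurable_fun D g ->
  \int[mu]_(x in D) (f x + g x) <=
  \int[mu]_(x in D) f x + \int[mu]_(x in D) g x.
Proof.
move=> mD f0 g0 mg; rewrite !(integral_mkcond D).
have {}mg : measurable_fun setT (g \_ D) by apply/(measurable_restrictT _ mD).
have -> : (fun x => f x + g x) \_ D = (fun x => (f \_ D) x + (g \_ D) x).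
  by apply/funext => x; rewrite !patchE; case: ifPn => // _; rewrite adde0.
have {}f0 x : 0 <= (f \_ D) x by apply: erestrict_ge0 => y /f0.
have {}g0 x : 0 <= (g \_ D) x by apply: erestrict_ge0 => y /g0.
move: (f \_ D) (g \_ D) f0 g0 mg => {}f {}g f0 g0 mg.
rewrite [leLHS]ge0_integralTE; last by move=> x; rewrite adde_ge0.
apply: ge_ereal_sup => _ [/= h hfg <-].
have mh : measurable_fun setT (EFin \o h).
  by apply/measurable_EFinP; exact: measurable_funP.
rewrite -integralT_nnsfun.
pose k x := maxe ((h x)%:E - g x) 0.
have mk : measurable_fun setT k.
  by apply: measurable_maxe => //; exact: emeasurable_funB.
have k0 x : 0 <= k x by rewrite le_max lexx orbT.
apply: (@le_trans _ _ (\int[mu]_x (k x + g x))).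
  apply: ge0_le_lower_integralT => x; first by rewrite lee_fin.
  rewrite /k; case: (g x) (g0 x) => [r||] //= r0.
    by rewrite -leeBlDr// le_max lexx.
  by rewrite addey ?leey// -ltNye; apply: (@lt_le_trans _ _ 0) => //; rewrite le_max lexx orbT.
rewrite ge0_integralD//; apply: leeD2r.
apply: ge0_le_lower_integralT => // x.
rewrite /k ge_max f0 andbT.
case: (g x) (g0 x) (hfg x) => [r||] // r0.
  by rewrite leeBlDr.
by rewrite addeNy leNye.
Qed.

End lower_integral.

Section density.
Context {d : measure_display} {T : measurableType d} {R : realType}.
Import HBNNSimple.
Local Open Scope ereal_scope.

(** On simple functions both sides agree, and a simple function below f stays
below f after multiplication by the density. *)
Lemma integral_density_le (mu nu : {measure set T -> \bar R}) (g f : T -> \bar R) :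
  (forall x, 0 <= g x) -> measurable_fun setT g ->
  (forall A, measurable A -> nu A = \int[mu]_(x in A) g x) ->
  (forall x, 0 <= f x) ->
  \int[nu]_x f x <= \int[mu]_x (f x * g x).
Proof.
move=> g0 mg nuE f0; rewrite [leLHS]ge0_integralTE//.
apply: ge_ereal_sup => _ [/= h hf <-].
apply: (@le_trans _ _ (\int[mu]_x ((h x)%:E * g x))); last first.
  apply: ge0_le_lower_integralT => x; first by rewrite mule_ge0// lee_fin.
  by rewrite lee_wpmul2r.
rewrite sintegralE.
under [leRHS]eq_integral => x _.
  rewrite fimfunE -fsumEFin// ge0_mule_fsuml; last first.
    by move=> r; rewrite nnfun_muleindic_ge0.
  over.
rewrite ge0_integral_fsum//; last 2 first.
- move=> r; apply: emeasurable_funM => //.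
  by apply/measurable_EFinP; apply: measurable_funM => //; exact: measurable_indic.
- by move=> r x _; rewrite mule_ge0// nnfun_muleindic_ge0.
apply: lee_fsum => // r _.
have [r0|r0] := ltP r 0%R.
  rewrite preimage_nnfun0// measure0 mule0.
  by apply: integral_ge0 => x _; rewrite mule_ge0// lee_fin indicE memNset ?mulr0.
under [leRHS]eq_integral do rewrite EFinM -muleA.
rewrite ge0_integralZl//; last first.
- by move=> x _; rewrite mule_ge0// lee_fin.
- by apply: emeasurable_funM => //; apply/measurable_EFinP; exact: measurable_indic.
rewrite nuE// integral_mkcond; apply: lee_wpmul2l; first by rewrite lee_fin.
apply: ge0_le_lower_integralT => x; first by apply: erestrict_ge0.
rewrite patchE indicE; case: ifPn => xh; first by rewrite mul1e.
by rewrite mul0e.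
Qed.
End density.

(** * Even moments of Gaussian variables *)

Section gaussian_moments.
Context {R : realType}.

(** Bounds an even power by the two exponentials whose Gaussian integrals are
explicit. *)
Lemma expr_even_le_expR (x : R) n :
  x ^+ n.*2 <= (n.*2)`!%:R * (expR x + expR (- x)).
Proof.
have -> : x ^+ n.*2 = `|x| ^+ n.*2 by rewrite -normrX ger0_norm// exprn_even_ge0// odd_double.
have h : expR `|x| <= expR x + expR (- x).
  by case: (ger0P x) => _; [rewrite lerDl expR_ge0|rewrite lerDr expR_ge0].
rewrite mulrC -ler_pdivrMr ?ltr0n ?fact_gt0//; apply: le_trans h.
case: n => [|n]; first by rewrite expr0 fact0 divr1 -expR0 ler_expR.
rewrite doubleS; apply: le_trans (expR_ge1Dxn n.*2.+1 (normr_ge0 x)).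
by rewrite lerDr.
Qed.

(** Completing the square: an exponential tilt only translates a Gaussian
density. *)
Lemma expR_normal_pdf (a m s x : R) : s != 0 ->
  expR (a * x) * normal_pdf m s x =
  expR (a * m + a ^+ 2 * s ^+ 2 / 2) * normal_pdf (m + a * s ^+ 2) s x.
Proof.
move=> s0; rewrite !normal_pdfE// /normal_fun mulrCA [RHS]mulrCA -!expRD.
by congr (_ * expR _); rewrite -[s ^+ 2 *+ 2]mulr_natr; field.
Qed.

Lemma normal_peakE (s : R) : 0 < s -> normal_peak s = (s * Num.sqrt (pi *+ 2))^-1.
Proof.
move=> s0; rewrite /normal_peak -mulrnAr sqrtrM ?sqr_ge0//.
by rewrite sqrtr_sqr gtr0_norm.
Qed.

(** The minimum of the standard Gaussian density on [-2, 2]. *)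
Definition normal_tail_const : R := expR (- 2) / Num.sqrt (pi *+ 2).

Lemma normal_tail_const_gt0 : 0 < normal_tail_const.
Proof. by rewrite divr_gt0 ?expR_gt0// sqrtr_gt0 pmulrn_lgt0// pi_gt0. Qed.

Lemma normal_prob_far (m s a b : R) : 0 < s -> b - a = s ->
  (forall x, a <= x <= b -> `|x - m| <= 2 * s) ->
  (normal_tail_const%:E <= normal_prob m s `[a, b])%E.
Proof.
move=> s0 bas far.
have ab : a < b by rewrite -subr_gt0 bas.
apply: (@le_trans _ _ (\int[lebesgue_measure]_(x in `[a, b]) (normal_peak s * expR (- 2))%:E)%E).
  rewrite integral_cst//= lebesgue_measure_itv/= lte_fin ab -EFinB bas -EFinM lee_fin.
  rewrite normal_peakE// /normal_tail_const.
  rewrite invfM; set q := _^-1.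
  by rewrite -!mulrA [leRHS]mulrC -!mulrA mulfV ?gt_eqF// mulr1 mulrC.
apply: ge0_le_lower_integral => x /=; rewrite in_itv/= => xab.
  by rewrite lee_fin mulr_ge0 ?normal_peak_ge0 ?expR_ge0.
rewrite lee_fin normal_pdfE ?gt_eqF// ler_wpM2l ?normal_peak_ge0//.
rewrite /normal_fun ler_expR mulNr lerN2 ler_pdivrMr ?pmulrn_lgt0 ?exprn_gt0//.
rewrite -real_normK ?num_real//; have := far _ xab => /(lerXn2r 2).
rewrite !nnegrE normr_ge0 mulr_ge0 ?(ltW s0)// => /(_ isT isT) /le_trans; apply.
by rewrite exprMn -mulr_natr; lra.
Qed.

End gaussian_moments.

Section gaussian_moments2.
Context {d : measure_display} {T : measurableType d} {R : realType}.
Variable P : probability T R.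

Lemma markov_ge (f : T -> \bar R) (A : set T) (c : R) : measurable A -> 0 <= c ->
  (forall w, 0 <= f w)%E -> (forall w, A w -> c%:E <= f w)%E ->
  (c%:E * P A <= \int[P]_w f w)%E.
Proof.
move=> mA c0 f0 cf; rewrite -integral_cst// integral_mkcond.
apply: ge0_le_lower_integralT => w; first by apply: erestrict_ge0 => *; rewrite lee_fin.
by rewrite patchE; case: ifPn => // /set_mem/cf.
Qed.

(** A Gaussian variable of parameters m and s is, with a probability bounded
below, at distance at least |m| + s from 0: the relevant interval lies beyond m
on the side away from 0.  This controls both parameters by the second moment
alone. *)
Lemma gaussian_parameters_le (X : {RV P >-> R}) (m s sigma : R) :
  0 < s -> 0 <= sigma ->
  (forall A, measurable A -> P (X @^-1` A) = normal_prob m s A) ->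
  (\int[P]_w (X w ^+ 2)%:E = (sigma ^+ 2)%:E)%E ->
  (`|m| + s) ^+ 2 * normal_tail_const <= sigma ^+ 2.
Proof.
move=> s0 sig0 lawX EX2.
(* The interval of length s between one and two standard deviations from the
   mean, on the side away from 0. *)
have [a [b [bas far big]]] : exists a b : R, [/\ b - a = s,
    (forall x, a <= x <= b -> `|x - m| <= 2 * s) &
    (forall x, a <= x <= b -> `|m| + s <= `|x|)].
  have [m0|m0] := ger0P m.
    exists (m + s), (m + 2 * s); split => [|x /andP[ax xb]|x /andP[ax xb]].
    - by ring.
    - by rewrite ger0_norm; lra.
    - by rewrite ger0_norm; lra.
  exists (m - 2 * s), (m - s); split => [|x /andP[ax xb]|x /andP[ax xb]].
  - by ring.
  - by rewrite ler0_norm; lra.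
  - by rewrite ler0_norm; lra.
rewrite -lee_fin EFinM -EX2.
have := normal_prob_far s0 bas far; rewrite -lawX// => h.
apply: le_trans (lee_wpmul2l _ h) _; first by rewrite lee_fin sqr_ge0.
apply: markov_ge => //.
- by rewrite -[_ @^-1` _]setTI; exact: measurable_funPT.
- exact: sqr_ge0.
- by move=> w; rewrite lee_fin sqr_ge0.
- move=> w /=; rewrite in_itv/= => /big h'; rewrite lee_fin -[leRHS]real_normK ?num_real//.
  by rewrite lerXn2r// nnegrE ?addr_ge0// ltW.
Qed.

(** Change of variables, with the law given only by its values on measurable
sets. *)
Lemma integral_law (X : {RV P >-> R}) (nu : {measure set (measurableTypeR R) -> \bar R}) (f : R -> R) :
  (forall A, measurable A -> P (X @^-1` A) = nu A) ->
  measurable_fun setT f -> (forall x, 0 <= f x) ->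
  (\int[P]_w (f (X w))%:E = \int[nu]_x (f x)%:E)%E.
Proof.
move=> lawX mf f0.
have mX : measurable_fun setT (X : T -> measurableTypeR R).
  exact: (measurable_funPT X).
(* R and measurableTypeR R carry the same sigma-algebra under two structures;
   repackaging X puts its law on the type where Lebesgue measure lives. *)
pose X' : {RV P >-> measurableTypeR R} :=
  HB.pack (X : T -> measurableTypeR R) (isMeasurableFun.Build _ _ _ _ _ mX).
transitivity (\int[distribution P X']_x (EFin \o f) x)%E.
  symmetry; apply: (@ge0_integral_distribution _ _ _ _ _ _ X' (EFin \o f)) => //.
  by apply/measurable_EFinP.
by apply: eq_measure_integral => A mA _; exact: lawX.
Qed.

(** After scaling by sigma, an even power is dominated by two exponentials.
Their integrals are bounded because [gaussian_parameters_le] makes the mean and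
the deviation at most a constant multiple of sigma. *)
Lemma gaussian_even_moment (n : nat) : exists2 c : R, 0 <= c &
  forall (X : {RV P >-> R}) (sigma : R), 0 < sigma -> gaussian_variable P X ->
    (\int[P]_w (X w ^+ 2)%:E = (sigma ^+ 2)%:E)%E ->
    (\int[P]_w (X w ^+ n.*2)%:E <= (c * sigma ^+ n.*2)%:E)%E.
Proof.
pose k := (Num.sqrt (@normal_tail_const R))^-1.
have k0 : 0 < k by rewrite invr_gt0 sqrtr_gt0 normal_tail_const_gt0.
pose c : R := (n.*2)`!%:R * (expR (k + k ^+ 2 / 2) *+ 2).
have c0 : 0 <= c by rewrite mulr_ge0// mulrn_wge0// expR_ge0.
exists (1 + c) => [|X sigma sig0 [m [s [s0 lawX]]] EX2]; first by rewrite addr_ge0.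
have mX k' : measurable_fun setT (fun x : R => x ^+ k') by exact: measurable_funX.
have even0 (x : R) : 0 <= x ^+ n.*2 by rewrite exprn_even_ge0// odd_double.
have [s00|s00] := eqVneq s 0.
  have lawX' A : measurable A -> P (X @^-1` A) = \d_(m : measurableTypeR R) A.
    by move=> mA; rewrite lawX// /gaussian_law s00 eqxx.
  have := EX2; rewrite (@integral_law X (dirac (m : measurableTypeR R)) (fun x => x ^+ 2))//; last first.
    by move=> x; exact: sqr_ge0.
  rewrite integral_dirac//= ?diracT ?mul1e; last by apply/measurable_EFinP; exact: mX.
  case=> ms; rewrite (@integral_law X (dirac (m : measurableTypeR R)) (fun x => x ^+ n.*2))//.
  rewrite integral_dirac//= ?diracT ?mul1e; last by apply/measurable_EFinP; exact: mX.
  rewrite lee_fin -muln2 mulnC !exprM ms ler_peMl ?lerDl//.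
  by rewrite exprn_ge0// sqr_ge0.
have {}s0 : 0 < s by rewrite lt_neqAle eq_sym s00.
have {}lawX A : measurable A -> P (X @^-1` A) = normal_prob m s A.
  by move=> mA; rewrite lawX// /gaussian_law (negbTE s00).
have msle : `|m| + s <= k * sigma.
  have := gaussian_parameters_le s0 (ltW sig0) lawX EX2.
  rewrite -ler_pdivlMr ?normal_tail_const_gt0// => h.
  rewrite -[leLHS]ger0_norm ?addr_ge0 ?(ltW s0)// -sqrtr_sqr.
  apply: le_trans (ler_wsqrtr h) _.
  by rewrite sqrtrM ?sqr_ge0// sqrtr_sqr gtr0_norm// sqrtrV ?(ltW (normal_tail_const_gt0))// mulrC.
have mk : `|m| <= k * sigma by apply: le_trans msle; rewrite lerDl ltW.
have sk : s <= k * sigma by apply: le_trans msle; rewrite lerDr.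
pose nu : probability (measurableTypeR R) R := normal_prob m s.
rewrite (@integral_law X nu (fun x => x ^+ n.*2))//.
apply: (@le_trans _ _ (\int[lebesgue_measure]_x
    ((x ^+ n.*2)%:E * (normal_pdf m s x)%:E))%E).
  apply: integral_density_le => //.
  - by move=> x; rewrite lee_fin normal_pdf_ge0.
  - by apply/measurable_EFinP; exact: measurable_normal_pdf.
pose a := sigma^-1.
pose K := (n.*2)`!%:R * sigma ^+ n.*2.
pose e (b : R) := expR (b * m + b ^+ 2 * s ^+ 2 / 2).
apply: (@le_trans _ _ (\int[lebesgue_measure]_x
   ((K * e a)%:E * (normal_pdf (m + a * s ^+ 2) s x)%:E +
    (K * e (- a))%:E * (normal_pdf (m + (- a) * s ^+ 2) s x)%:E))%E).
  apply: ge0_le_lower_integralT => x.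
    by rewrite -EFinM lee_fin mulr_ge0 ?normal_pdf_ge0.
  rewrite -!EFinM -EFinD lee_fin -!(mulrA K) /e -!expR_normal_pdf//.
  rewrite [leRHS](_ : _ = K * (expR (a * x) + expR (- a * x)) * normal_pdf m s x);
    last by ring.
  apply: ler_wpM2r; first exact: normal_pdf_ge0.
  have := expr_even_le_expR (a * x) n; rewrite mulNr exprMn exprVn => h.
  rewrite /K mulrAC -ler_pdivrMr ?exprn_gt0// mulrC.
  exact: h.
have K0 : 0 <= K by rewrite mulr_ge0// exprn_ge0// ltW.
have e0 b : 0 <= e b by exact: expR_ge0.
rewrite ge0_integralD//; first last.
- by apply/measurable_EFinP; apply: measurable_funM => //; exact: measurable_normal_pdf.
- by move=> x _; rewrite -EFinM lee_fin mulr_ge0 ?normal_pdf_ge0// mulr_ge0.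
- by apply/measurable_EFinP; apply: measurable_funM => //; exact: measurable_normal_pdf.
- by move=> x _; rewrite -EFinM lee_fin mulr_ge0 ?normal_pdf_ge0// mulr_ge0.
rewrite !ge0_integralZl//; first last.
- by rewrite lee_fin mulr_ge0.
- by move=> x _; rewrite lee_fin normal_pdf_ge0.
- by apply/measurable_EFinP; exact: measurable_normal_pdf.
- by rewrite lee_fin mulr_ge0.
- by move=> x _; rewrite lee_fin normal_pdf_ge0.
- by apply/measurable_EFinP; exact: measurable_normal_pdf.
rewrite !integral_normal_pdf !mule1 -EFinD lee_fin.
have eb b : `|b| = a -> e b <= expR (k + k ^+ 2 / 2).
  move=> ba; rewrite ler_expR lerD//.
    apply: le_trans (ler_norm _) _; rewrite normrM ba /a mulrC.
    by rewrite ler_pdivrMr.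
  rewrite ler_wpM2r// -[b ^+ 2]real_normK ?num_real// ba -exprMn.
  rewrite lerXn2r ?nnegrE ?mulr_ge0 ?(ltW k0) ?(ltW s0)//; last first.
    by rewrite /a mulrC ler_pdivrMr.
  by rewrite /a invr_ge0 ltW.
have a0 : `|a| = a by rewrite gtr0_norm// invr_gt0.
have e1 := eb a a0; have e2 : e (- a) <= expR (k + k ^+ 2 / 2) by apply: eb; rewrite normrN.
rewrite -mulrDr [leRHS]mulrDl; apply: (@le_trans _ _ (c * sigma ^+ n.*2)); last first.
  by rewrite lerDr mul1r.
rewrite /K /c mulrAC [leRHS]mulrAC -mulrA -[leRHS]mulrA.
by rewrite ler_wpM2l// mulrC ler_wpM2l// mulr2n lerD.
Qed.

End gaussian_moments2.

Lemma same_law_integral {d : measure_display} {T : measurableType d} {R : realType}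
  (P : probability T R) (X Y : {RV P >-> R}) (f : R -> R) :
  same_law P X Y -> measurable_fun setT f -> (forall x, 0 <= f x) ->
  (\int[P]_w (f (X w))%:E = \int[P]_w (f (Y w))%:E)%E.
Proof.
move=> lawXY mf f0.
have mY : measurable_fun setT (Y : T -> measurableTypeR R).
  exact: (measurable_funPT Y).
pose Y' : {RV P >-> measurableTypeR R} :=
  HB.pack (Y : T -> measurableTypeR R) (isMeasurableFun.Build _ _ _ _ _ mY).
by rewrite !(@integral_law _ _ _ P _ (distribution P Y')).
Qed.

(** * Increments of fractional Brownian motion *)

Section fbm_moments.
Context {d : measure_display} {T : measurableType d} {R : realType}.
Variables (P : probability T R) (H : R).
Hypotheses (hH : 2^-1 <= H) (hH1 : H < 1).
Variable W : R -> {RV P >-> R}.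
Hypothesis hW : fractional_brownian_motion H W.

Lemma fbm_second_moment (t : R) : 0 <= t ->
  (\int[P]_w (W t w ^+ 2)%:E = ((t `^ H) ^+ 2)%:E)%E.
Proof.
move=> t0; have H0 : 0 < H by apply: lt_le_trans hH; rewrite invr_gt0.
have := fbm_covariance hW t0 t0.
rewrite subrr normr0 powR0 ?gt_eqF ?mulr_gt0// subr0.
rewrite covariance.unlock (fbm_centered hW t0)/= => h.
have -> : (t `^ H) ^+ 2 = 2^-1 * (t `^ (2 * H) + t `^ (2 * H)).
  by rewrite [2 * H]mulrC powRrM powR_mulrn ?powR_ge0//; lra.
rewrite -h expectation.unlock; apply: eq_integral => w _.
by transitivity ((W t w - 0) * (W t w - 0))%:E => //; rewrite subr0 expr2.
Qed.

Lemma fbm_gaussian_variable (t : R) : 0 <= t -> gaussian_variable P (W t).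
Proof.
move=> t0; have := @fbm_gaussian _ _ _ _ _ _ hW 1 (fun=> t) (fun=> 1) (fun=> t0).
by congr gaussian_variable; apply/funext => w; rewrite big_ord1 mul1r.
Qed.

Lemma fbm_increment_law (s t : R) (A : set R) : 0 <= s -> 0 <= t -> measurable A ->
  P [set w | A (W (t + s) w - W s w)] = P (W t @^-1` A).
Proof.
move=> s0 t0 mA.
have mA' : measurable [set x : 1.-tuple R | A (tnth x ord0)].
  by rewrite -[X in measurable X]setTI; apply: measurable_tnth.
have := @fbm_increments _ _ _ _ _ _ hW s s0 1 (fun=> t) (fun=> t0) _ mA'.
rewrite /preimage/=; under eq_set do rewrite tnth_mktuple.
move=> ->; congr (P _); apply/funext => w /=.
by rewrite tnth_mktuple (fbm_start hW) subr0.
Qed.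

Lemma fbm_increment_moment (n : nat) : exists2 c : R, 0 <= c &
  forall s t : R, 0 <= s -> 0 < t ->
    (\int[P]_w ((W (t + s) w - W s w) ^+ n.*2)%:E <= (c * (t `^ H) ^+ n.*2)%:E)%E.
Proof.
have [c c0 hc] := gaussian_even_moment P n; exists c => // s t s0 t0.
have mI : measurable_fun setT (fun w => W (t + s) w - W s w).
  exact: measurable_funB.
pose I : {RV P >-> R} := HB.pack (fun w => W (t + s) w - W s w)
  (isMeasurableFun.Build _ _ _ _ _ mI).
have mp : measurable_fun setT (fun x : R => x ^+ n.*2) by exact: measurable_funX.
have p0 (x : R) : 0 <= x ^+ n.*2 by rewrite exprn_even_ge0// odd_double.
rewrite (@same_law_integral _ _ _ P I (W t) (fun x => x ^+ n.*2))//; last first.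
  by move=> A mA; rewrite -(fbm_increment_law s0 (ltW t0) mA).
apply: hc; first exact: powR_gt0.
- exact: fbm_gaussian_variable (ltW t0).
- exact: fbm_second_moment (ltW t0).
Qed.

(** Over short times the variance t^(2H) is at most t, since 2H >= 1. *)
Lemma powR_small_le (t : R) n : 0 < t <= 1 -> (t `^ H) ^+ n.*2 <= t ^+ n.
Proof.
move=> t01; have t0 : 0 < t by case/andP: t01.
rewrite -muln2 mulnC exprM lerXn2r ?nnegrE ?exprn_ge0 ?powR_ge0 ?(ltW t0)//.
rewrite -powR_mulrn ?powR_ge0// -powRrM; apply: ge1r_powR => //.
by have := hH; lra.
Qed.

(** Over long times the variance t^(2H) is smaller than t^2 by a fixed power of
t, so a high enough moment gains any prescribed power. *)
Lemma powR_large_le (k : nat) : exists2 n : nat, (k <= n)%N &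
  forall t : R, 1 <= t -> (t `^ H) ^+ n.*2 * t ^+ k <= t ^+ n.*2.
Proof.
pose n := maxn k (Num.truncn (k%:R / (2 * (1 - H)))).+1.
exists n => [|t t1]; first exact: leq_maxl.
have t0 : 0 <= t by lra.
rewrite -powR_mulrn ?powR_ge0// -powRrM -!(powR_mulrn _ t0) -powRD; last first.
  by apply/implyP => _; rewrite gt_eqF// (lt_le_trans _ t1).
apply: ler_powR => //.
have : k%:R / (2 * (1 - H)) <= n%:R.
  apply: le_trans (ltW (truncnS_gt _)) _.
  by rewrite ler_nat leq_maxr.
rewrite ler_pdivrMr; last by have := hH1; rewrite -subr_gt0 => ?; rewrite mulr_gt0.
by rewrite -muln2 natrM; nra.
Qed.

End fbm_moments.

(** * Chaining over dyadic points *)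

Section chaining.
Context {R : realType}.

Lemma within_continuous_dist (f : R -> R) (t : R) :
  {within `[0, +oo[, continuous f} -> 0 <= t ->
  forall e : R, 0 < e -> exists2 del : R, 0 < del &
    forall z : R, 0 <= z -> `|t - z| < del -> `|f t - f z| < e.
Proof.
move=> cf t0 e e0; have tA : `[0, +oo[%classic t by rewrite /= in_itv/= t0.
move/subspace_continuousP: cf => /(_ t tA)/cvgrPdist_lt /(_ _ e0) [del /= del0 hdel].
exists del => // z z0 tz; apply: hdel => //=.
by rewrite in_itv/= z0.
Qed.

Variables (f : R -> R) (a y : R).
Hypotheses (y0 : 0 <= y).
Hypothesis step : forall k j, (j < 2 ^ k)%N ->
  `|f (a + j.+1%:R / 2 ^+ k) - f (a + j%:R / 2 ^+ k)| <= (4 / 5) ^+ k * y.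

(** A dyadic point of level k + 1 is either a point of level k or one step to
the right of one, so the steps add up along a geometric series. *)
Lemma dyadic_chain k j : (j <= 2 ^ k)%N ->
  `|f (a + j%:R / 2 ^+ k) - f a| <= 5 * (1 - (4 / 5) ^+ k.+1) * y.
Proof.
elim: k j => [|k IHk] j.
  rewrite expn0 leq_eqVlt ltnS leqn0 => /orP[|] /eqP -> {j}; last first.
    by rewrite mul0r addr0 subrr normr0 expr1; have := y0; lra.
  have := @step 0 0 (ltn0Sn _); rewrite mul0r addr0 !expr0 => /le_trans; apply.
  by rewrite expr1; have := y0; lra.
have rk0 : 0 <= (4 / 5 : R) ^+ k.+1 by rewrite exprn_ge0.
have half h : (h.*2%:R : R) / 2 ^+ k.+1 = h%:R / 2 ^+ k.
  by rewrite -mul2n natrM exprS -mulf_div divff ?mul1r.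
rewrite -[j]odd_double_half; case: (odd j); rewrite ?add0n ?add1n => hj.
  have hk : (j./2 < 2 ^ k)%N by move: hj; rewrite expnS mul2n ltn_double.
  have := @step k.+1 j./2.*2 hj; rewrite half => h1.
  have := IHk _ (ltnW hk) => h2.
  apply: le_trans (ler_distD (f (a + (j./2)%:R / 2 ^+ k)) _ _) _.
  apply: le_trans (lerD h1 h2) _.
  by rewrite [_ ^+ k.+2]exprS; lra.
have hk : (j./2 <= 2 ^ k)%N by move: hj; rewrite expnS mul2n leq_double.
rewrite half; apply: le_trans (IHk _ hk) _.
apply: ler_wpM2r => //; rewrite [_ ^+ k.+2]exprS; lra.
Qed.

Lemma chaining (t : R) : {within `[0, +oo[, continuous f} ->
  0 <= a -> a <= t <= a + 1 -> `|f t - f a| <= 5 * y.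
Proof.
move=> cf a0 /andP[at_ ta]; apply/ler_addgt0Pr => e e0.
have [del del0 hdel] := within_continuous_dist cf (le_trans a0 at_) e0.
have [k hk] : exists k : nat, (2 ^- k : R) < del.
  have [k _ hk] := near_infty_natSinv_expn_lt (PosNum del0).
  by exists k; have := hk k (leqnn _); rewrite /= div1r.
have pk0 : (0 : R) < 2 ^+ k by rewrite exprn_gt0.
pose j := Num.truncn ((t - a) * 2 ^+ k).
have x0 : 0 <= (t - a) * 2 ^+ k by rewrite mulr_ge0 ?(ltW pk0)// subr_ge0.
have /andP[jle jlt] := truncn_itv x0; rewrite -/j in jle jlt.
have j2 : (j <= 2 ^ k)%N.
  rewrite -(ler_nat R) natrX; apply: le_trans jle _.
  by rewrite ler_piMl ?(ltW pk0)//; lra.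
pose z := a + j%:R / 2 ^+ k.
have zt : `|t - z| < del.
  have h1 : j%:R / 2 ^+ k <= t - a by rewrite ler_pdivrMr.
  have h2 : t - a < j%:R / 2 ^+ k + 2 ^- k.
    have -> : j%:R / 2 ^+ k + 2 ^- k = j.+1%:R / 2 ^+ k :> R.
      by rewrite -[j.+1%:R]natr1 mulrDl mul1r.
    by rewrite ltr_pdivlMr.
  by rewrite ger0_norm /z; lra.
have z0 : 0 <= z by rewrite addr_ge0// divr_ge0// ltW.
apply: le_trans (ler_distD (f z) _ _) _.
rewrite addrC lerD//; last exact: ltW (hdel _ z0 zt).
apply: le_trans (dyadic_chain j2) _; apply: ler_wpM2r => //.
have : 0 <= (4 / 5 : R) ^+ k.+1 by rewrite exprn_ge0.
lra.
Qed.

End chaining.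

Section series_bounds.
Context {R : realType}.
Local Open Scope ereal_scope.

Lemma nneseries_le_bound (u : nat -> \bar R) (M : \bar R) :
  (forall k, 0 <= u k) -> (forall n, \sum_(0 <= k < n) u k <= M) ->
  \sum_(k <oo) u k <= M.
Proof.
move=> u0 uM; apply: lime_le; first exact: is_cvg_nneseries.
by apply: nearW => n; exact: uM.
Qed.

Lemma nneseries_ge_term (u : nat -> \bar R) k : (forall k, 0 <= u k) ->
  u k <= \sum_(k <oo) u k.
Proof.
move=> u0; have := @nneseries_lim_ge _ u xpredT 0%N k.+1 (fun i _ _ => u0 i).
apply: le_trans; rewrite big_nat_recr//= leeDr//.
exact: sume_ge0.
Qed.

Lemma sum_inv_pow2_le n : (\sum_(0 <= k < n) (2 : R) ^- k <= 2)%R.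
Proof.
have pos k : (0 <= (2:R) ^- k)%R by rewrite invr_ge0 exprn_ge0.
suff : (\sum_(0 <= k < n) (2 : R) ^- k = 2 - 2 * 2 ^- n)%R.
  by move=> ->; have := pos n; lra.
elim: n => [|n IHn]; first by rewrite big_nil expr0 invr1; lra.
by rewrite big_nat_recr//= IHn exprS invfM; lra.
Qed.

(** Telescoping against 1/n - 1/(n+1). *)
Lemma sum_inv_sqr_le n : (\sum_(0 <= k < n) (k.+1%:R ^- 2 : R) <= 2)%R.
Proof.
suff : (\sum_(0 <= k < n.+1) (k.+1%:R ^- 2 : R) <= 2 - n.+1%:R^-1)%R.
  rewrite big_nat_recr//= => h.
  have h1 : (0 <= n.+1%:R ^- 2 :> R)%R by rewrite invr_ge0 exprn_ge0.
  have h2 : (0 <= n.+1%:R^-1 :> R)%R by rewrite invr_ge0.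
  apply: (le_trans (y := (2 - n.+1%:R^-1)%R)); last by rewrite gerBl.
  by apply: le_trans h; rewrite lerDl.
elim: n => [|n IHn]; first by rewrite big_nat1 expr1n invr1; lra.
rewrite big_nat_recr//=; apply: le_trans (lerD IHn (lexx _)) _.
rewrite -addrA lerD2l -lerBrDl opprK addrC.
have x0 : (0 < n.+1%:R :> R)%R by [].
rewrite -[n.+2%:R]natr1; set x : R := n.+1%:R in x0 *.
have -> : (x^-1 - (x + 1)^-1 = (x * (x + 1))^-1)%R by field; lra.
rewrite lef_pV2 ?posrE; nra.
Qed.

End series_bounds.

Section chain_sum.
Context {d : measure_display} {T : measurableType d} {R : realType}.
Variables (P : probability T R).
Variable W : R -> {RV P >-> R}.

(** The weight (25/16)^(kn) is the inverse of ((4/5)^k)^(2n): a bound v on the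
sum bounds each increment of level k by (4/5)^k times the 2n-th root of v. *)
Definition chain_level (n : nat) (a : R) (k : nat) (w : T) : R :=
  \sum_(j < 2 ^ k)
    (W (a + j.+1%:R / 2 ^+ k) w - W (a + j%:R / 2 ^+ k) w) ^+ n.*2 *
    (25 / 16) ^+ (k * n).

(** A measurable, countable substitute for the 2n-th power of the oscillation
of the path on [a, a + 1]. *)
Definition chain_sum (n : nat) (a : R) (w : T) : \bar R :=
  (\sum_(k <oo) (chain_level n a k w)%:E)%E.

Lemma chain_term_ge0 n a k j w :
  0 <= (W (a + j.+1%:R / 2 ^+ k) w - W (a + j%:R / 2 ^+ k) w) ^+ n.*2 *
    (25 / 16) ^+ (k * n).
Proof.
by apply: mulr_ge0; [rewrite exprn_even_ge0// odd_double|exact: exprn_ge0].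
Qed.

Lemma chain_level_ge0 n a k w : 0 <= chain_level n a k w.
Proof. by apply: sumr_ge0 => j _; exact: chain_term_ge0. Qed.

Lemma chain_sum_ge0 n a w : (0 <= chain_sum n a w)%E.
Proof. by apply: nneseries_ge0 => k _ _; rewrite lee_fin chain_level_ge0. Qed.

Lemma measurable_chain_term n a k j : measurable_fun setT (fun w =>
  (W (a + j.+1%:R / 2 ^+ k) w - W (a + j%:R / 2 ^+ k) w) ^+ n.*2 *
    (25 / 16) ^+ (k * n)).
Proof. by apply: measurable_funM => //; apply: measurable_funX; exact: measurable_funB. Qed.

Lemma measurable_chain_sum n a : measurable_fun setT (chain_sum n a).
Proof.
apply: ge0_emeasurable_sum => [k w _ _|k _].
  by rewrite lee_fin chain_level_ge0.
apply/measurable_EFinP; apply: measurable_sum => j; exact: measurable_chain_term.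
Qed.

Lemma oscillation_le_chain_sum n (a t : R) w : (0 < n)%N ->
  {within `[0, +oo[, continuous (W ^~ w)} -> 0 <= a -> a <= t <= a + 1 ->
  (((W t w - W a w) ^+ n.*2)%:E <= (5 ^+ n.*2)%:E * chain_sum n a w)%E.
Proof.
move=> n0 cW a0 at_.
have := chain_sum_ge0 n a w; rewrite /chain_sum.
have := nneseries_ge_term _ (fun k => chain_level_ge0 n a k w : (0 <= (chain_level n a k w)%:E)%E).
case: (\sum_(k <oo) _)%E => [v||] // vge v0; last first.
  by rewrite gt0_muley ?leey// lte_fin exprn_gt0.
rewrite -EFinM lee_fin.
have [y y0 yv] : exists2 y : R, 0 <= y & y ^+ n.*2 = v.
  exists (v `^ (n.*2%:R^-1)); first exact: powR_ge0.
  rewrite -powR_mulrn ?powR_ge0// -powRrM mulVf ?powRr1//.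
  by rewrite pnatr_eq0 double_eq0 -lt0n.
rewrite -yv -exprMn -[leLHS]ger0_norm ?exprn_even_ge0 ?odd_double// normrX.
apply: lerXn2r; rewrite ?nnegrE ?mulr_ge0//.
apply: (@chaining _ (W ^~ w) a y y0 _ t) => // k j j2.
rewrite -(@ler_pXn2r _ n.*2) ?nnegrE ?mulr_ge0 ?exprn_ge0// ?double_gt0//.
rewrite exprMn yv -normrX ger0_norm ?exprn_even_ge0 ?odd_double//.
have -> : ((4 / 5 : R) ^+ k) ^+ n.*2 = ((25 / 16) ^+ (k * n))^-1.
  rewrite -exprM -[n.*2]mul2n mulnCA exprM -exprVn; congr (_ ^+ _).
  by rewrite expr2; field.
rewrite [leRHS]mulrC ler_pdivlMr ?exprn_gt0 ?divr_gt0//.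
have := vge k; rewrite lee_fin; apply: le_trans.
rewrite /chain_level (bigD1 (Ordinal j2))//= lerDl.
by apply: sumr_ge0 => i _; exact: chain_term_ge0.
Qed.

Variable H : R.
Hypothesis hH : 2^-1 <= H.
Hypothesis hW : fractional_brownian_motion H W.

(** Level k has 2^k increments, each of 2n-th moment at most 2^(-kn) up to a
constant.  With the weight, level k contributes (2 (25/32)^n)^k, and n >= 6
makes the ratio at most 1/2. *)
Lemma expectation_chain_sum_le n : (6 <= n)%N -> exists2 c : R, 0 <= c &
  forall a, 0 <= a -> (\int[P]_w chain_sum n a w <= c%:E)%E.
Proof.
move=> n6; have [c c0 hc] := fbm_increment_moment hH hW n.
exists (c * 2); first by rewrite mulr_ge0.
move=> a a0; rewrite integral_nneseries//; first last.
- by move=> k w _; rewrite lee_fin chain_level_ge0.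
- move=> k; apply/measurable_EFinP; apply: measurable_sum => j.
  exact: measurable_chain_term.
apply: nneseries_le_bound => [k|N].
  by apply: integral_ge0 => w _; rewrite lee_fin chain_level_ge0.
apply: (@le_trans _ _ (\sum_(0 <= k < N) (c * 2 ^- k)%:E)%E); last first.
  rewrite sumEFin lee_fin -mulr_sumr ler_wpM2l//.
  exact: sum_inv_pow2_le.
apply: lee_sum => k _.
under eq_integral do rewrite /chain_level -sumEFin.
rewrite ge0_integral_sum//; first last.
- by move=> j w _; rewrite lee_fin chain_term_ge0.
- by move=> j; apply/measurable_EFinP; exact: measurable_chain_term.
pose q := c * (2 ^- k) ^+ n * (25 / 16) ^+ (k * n).
apply: (@le_trans _ _ (\sum_(j < 2 ^ k) q%:E)%E).
  apply: lee_sum => j _.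
  under eq_integral do rewrite EFinM.
  rewrite ge0_integralZr//; first last.
  - by move=> w _; rewrite lee_fin exprn_even_ge0// odd_double.
  - by apply/measurable_EFinP; apply: measurable_funX; exact: measurable_funB.
  rewrite EFinM; apply: lee_wpmul2r; first by rewrite lee_fin exprn_ge0.
  have -> : a + j.+1%:R / 2 ^+ k = 2 ^- k + (a + j%:R / 2 ^+ k).
    by rewrite -[j.+1%:R]natr1 mulrDl mul1r; ring.
  apply: le_trans (hc _ _ _ _) _.
  - by rewrite addr_ge0// divr_ge0// exprn_ge0.
  - by rewrite invr_gt0 exprn_gt0.
  - rewrite lee_fin ler_wpM2l//; apply: (powR_small_le hH).
    by rewrite invr_gt0 exprn_gt0//= invf_le1 ?exprn_gt0// exprn_ege1// ler1n.
rewrite sumEFin lee_fin sumr_const card_ord -[leLHS]mulr_natl natrX /q.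
rewrite -exprVn -exprM [(k * n)%N]mulnC !exprM.
have -> : 2 ^+ k * (c * 2^-1 ^+ n ^+ k * (25 / 16) ^+ n ^+ k) =
    c * (2 * (25 / 32) ^+ n) ^+ k.
  have -> : 25 / 32 = 2^-1 * (25 / 16) :> R by lra.
  have gen (x y z : R) : z ^+ k * (c * y ^+ n ^+ k * x ^+ n ^+ k) =
      c * (z * (y * x) ^+ n) ^+ k by rewrite !exprMn !mulrA [z ^+ k * c]mulrC.
  exact: gen.
rewrite ler_wpM2l//; apply: lerXn2r; rewrite ?nnegrE ?mulr_ge0 ?exprn_ge0//.
have h6 : (25 / 32 : R) ^+ n <= (25 / 32) ^+ 6.
  by apply: ler_wiXn2l => //; lra.
have h2 : (25 / 32 : R) ^+ 2 <= 5 / 8 by rewrite expr2; lra.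
have h3 : (25 / 32 : R) ^+ 6 <= (5 / 8) ^+ 3.
  by rewrite (exprM _ 2 3); apply: lerXn2r; rewrite ?nnegrE ?exprn_ge0 ?divr_ge0.
have h4 : (5 / 8 : R) ^+ 3 <= 1 / 4 by rewrite !exprS expr0; lra.
by have := le_trans h6 (le_trans h3 h4); lra.
Qed.

End chain_sum.

(** * The reflected path *)

Section reflected_path.
Context {d : measure_display} {T : measurableType d} {R : realType}.
Variables (W : R -> T -> R) (u : R) (w : T).
Hypothesis cW : {within `[0, +oo[, continuous (W ^~ w)}.
Hypothesis W0 : W 0 w = 0.

Lemma inf_path_attained (x t : R) : 0 <= t -> exists2 c, 0 <= c <= t &
  inf [set x - u * s + W s w | s in `[0, t]] = x - u * c + W c w /\
  forall s, 0 <= s <= t -> x - u * c + W c w <= x - u * s + W s w.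
Proof.
move=> t0.
have cf : {within `[0, t], continuous (fun s => x - u * s + W s w)}.
  have sub : `[0, t] `<=` (`[0, +oo[ : set R).
    by move=> y /=; rewrite !in_itv/= => /andP[-> _].
  have lin : {within `[0, t], continuous (fun s => x - u * s)}.
    apply: continuous_subspaceT => y; apply: (@cvgB _ R^o); first exact: cvg_cst.
    by apply: cvgM; [exact: cvg_cst|exact: cvg_id].
  have cW' := continuous_subspaceW sub cW.
  by move=> z; apply: (@cvgD _ R^o); [exact: lin|exact: cW'].
have [c] := EVT_min t0 cf; rewrite in_itv/= => ct cmin.
exists c => //; split; last by move=> s st; apply: cmin; rewrite in_itv.
apply/eqP; rewrite eq_le; apply/andP; split.
  apply: ge_inf; last by exists c => //=; rewrite in_itv.
  by exists (x - u * c + W c w) => _ [s /= st <-]; apply: cmin.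
apply: lb_le_inf.
  by exists (x - u * c + W c w), c => //=; rewrite in_itv.
by move=> _ [s /= st <-]; apply: cmin.
Qed.

(** The value of the path at time 0 is 0, so truncating the infimum at 0 has no
effect. *)
Lemma regulator0_attained (t : R) : 0 <= t ->
  exists2 s, 0 <= s <= t & regulator W 0 u t w = u * s - W s w.
Proof.
move=> t0; have [c ct [infc cmin]] := inf_path_attained 0 t0.
exists c => //; rewrite /regulator infc.
have : 0 - u * c + W c w <= 0.
  have := cmin 0; rewrite lexx t0 mulr0 W0 subr0 addr0; exact.
by move=> h; rewrite min_r//; ring.
Qed.

Lemma regulator0_ge (s t : R) : 0 <= s <= t ->
  u * s - W s w <= regulator W 0 u t w.
Proof.
move=> st; have t0 : 0 <= t by case/andP: st => /le_trans; apply.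
have [c ct [infc cmin]] := inf_path_attained 0 t0.
rewrite /regulator infc; have := cmin s st; rewrite lerNr => h.
apply: le_trans (_ : - u * s + W s w <= _); last by lra.
by rewrite ge_min; apply/orP; right; lra.
Qed.

Lemma regulator0_ge0 (t : R) : 0 <= t -> 0 <= regulator W 0 u t w.
Proof.
move=> t0; have := @regulator0_ge 0 t; rewrite lexx t0 mulr0 W0 subr0.
exact.
Qed.

Lemma regulator0_homo (s t : R) : 0 <= s -> s <= t ->
  regulator W 0 u s w <= regulator W 0 u t w.
Proof.
move=> s0 st; have [c /andP[c0 cs] ->] := regulator0_attained s0.
by apply: regulator0_ge; rewrite c0 (le_trans cs).
Qed.

Lemma regulatorE (x t : R) : 0 <= x -> 0 <= t ->
  regulator W x u t w = Num.max 0 (regulator W 0 u t w - x).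
Proof.
move=> x0 t0; have [c ct [infc cmin]] := inf_path_attained x t0.
have [c' ct' h'] := regulator0_attained t0.
have h1 := regulator0_ge ct; have h2 := cmin _ ct'.
have -> : regulator W 0 u t w = u * c - W c w.
  by apply/eqP; rewrite eq_le h1 andbT h'; lra.
rewrite /regulator infc oppr_min oppr0; congr Num.max; ring.
Qed.

(** From x the boundary only has to push by the part of L that exceeds x, so
the regulator is the positive part of L - x. *)
Lemma stateE (x t : R) : 0 <= x -> 0 <= t ->
  state W x u t w = W t w - u * t + Num.max x (regulator W 0 u t w).
Proof.
move=> x0 t0; rewrite /state regulatorE//.
by case: (leP 0 (regulator W 0 u t w - x)) => h1;
  case: (leP x (regulator W 0 u t w)) => h2; lra.
Qed.

End reflected_path.

(** * Moments of the state, uniformly in time *)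

Section power_inequalities.
Context {R : realType}.

(** When a > b, the factor (a / b)^r is at least 1. *)
Lemma expr_excess_le (a b : R) q r : 0 <= a -> 0 < b -> (0 < q)%N ->
  Num.max 0 (a - b) ^+ q <= a ^+ (q + r) / b ^+ r.
Proof.
move=> a0 b0 q0; case: (leP 0 (a - b)) => ab; last first.
  rewrite expr0n; case: q q0 => // q _ /=.
  by rewrite divr_ge0 ?exprn_ge0// ltW.
rewrite ler_pdivlMr ?exprn_gt0// exprD; apply: ler_pM.
- exact: exprn_ge0.
- by rewrite exprn_ge0// ltW.
- by apply: lerXn2r; rewrite ?nnegrE// gerBl ltW.
- by apply: lerXn2r; rewrite ?nnegrE ?(ltW b0)//; lra.
Qed.

Lemma exprD2_le (a b : R) q : 0 <= a -> 0 <= b ->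
  (a + b) ^+ q <= 2 ^+ q * (a ^+ q + b ^+ q).
Proof.
move=> a0 b0; have aq := exprn_ge0 q a0; have bq := exprn_ge0 q b0.
apply: (@le_trans _ _ (2 ^+ q * Num.max a b ^+ q)).
  rewrite -exprMn; apply: lerXn2r; rewrite ?nnegrE ?addr_ge0//.
    by rewrite mulr_ge0// le_max a0.
  by case: (leP a b) => ?; lra.
apply: ler_wpM2l; first exact: exprn_ge0.
by case: (leP a b) => ?; rewrite ?lerDl ?lerDr.
Qed.

Lemma exprD3_le (a b c : R) q : 0 <= a -> 0 <= b -> 0 <= c ->
  (a + b + c) ^+ q <= 4 ^+ q * (a ^+ q + b ^+ q + c ^+ q).
Proof.
move=> a0 b0 c0; have c0q := exprn_ge0 q c0.
apply: le_trans (exprD2_le q (addr_ge0 a0 b0) c0) _.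
have -> : (4 : R) = 2 * 2 by lra.
rewrite exprMn -mulrA; apply: ler_wpM2l; first exact: exprn_ge0.
rewrite [leRHS]mulrDr; apply: lerD; first exact: exprD2_le.
by rewrite ler_peMl// exprn_ege1// ler1n.
Qed.

Lemma expr_le_1D (a : R) q k : 0 <= a -> (q <= k)%N -> a ^+ q <= 1 + a ^+ k.
Proof.
move=> a0 qk; have ak := exprn_ge0 k a0.
have [a1|a1] := leP a 1.
  apply: le_trans (_ : 1 <= _); last by rewrite lerDl.
  exact: exprn_ile1.
apply: (@le_trans _ _ (a ^+ k)); last by rewrite lerDr.
by apply: ler_weXn2l => //; exact: ltW.
Qed.

End power_inequalities.

Section state_moments.
Context {d : measure_display} {T : measurableType d} {R : realType}.
Variables (P : probability T R) (H : R).
Hypotheses (hH : 2^-1 <= H) (hH1 : H < 1).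
Variable W : R -> {RV P >-> R}.
Hypothesis hW : fractional_brownian_motion H W.
Variables (u x : R).
Hypotheses (u0 : 0 < u) (x0 : 0 <= x).

Let cW w : {within `[0, +oo[, continuous (W ^~ w)}.
Proof. exact: (fbm_continuous hW). Qed.

Let W0 w : W 0 w = 0.
Proof. exact: (fbm_start hW). Qed.

Lemma fbm_state_ge0 (t : R) w : 0 <= t -> 0 <= state W x u t w.
Proof.
move=> t0; rewrite (stateE u (@cW w) (@W0 w) x0 t0).
have := @regulator0_ge _ _ _ W u w (@cW w) t t; rewrite lexx t0 => /(_ isT) h.
apply: le_trans (_ : W t w - u * t + regulator W 0 u t w <= _); first lra.
by rewrite lerD2l le_max lexx orbT.
Qed.

(** The regulator is attained at some s, and i counts the unit intervals
between s and t.  The margin 2u in the constant term makes room for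
u(i + 1) in place of u(t - s) >= u(i - 1), so that the drift is
positive also when s and t lie in the same unit interval. *)
Lemma fbm_state_le_gaps (n : nat) (t : R) w : n%:R <= t < n.+1%:R ->
  exists2 i : nat, (i <= n)%N & exists2 s : R,
    (n - i)%:R <= s <= (n - i)%:R + 1 &
    state W x u t w <= (x + 2 * u) + `|W t w - W n%:R w| +
      Num.max 0 ((`|W n%:R w - W (n - i)%:R w| + `|W s w - W (n - i)%:R w|) -
                 u * i.+1%:R).
Proof.
move=> /andP[nt tn]; have t0 : 0 <= t by exact: le_trans nt.
have [s /andP[s0 st] Ls] := @regulator0_attained _ _ _ W u w (@cW w) (@W0 w) t t0.
have := truncn_itv s0; set j := Num.truncn s => /andP[js sj].
have jn : (j <= n)%N.
  by rewrite -ltnS -(ltr_nat R); apply: le_lt_trans tn; apply: le_trans st.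
exists (n - j)%N; first exact: leq_subr.
have nj : (n - (n - j))%N = j by rewrite subKn.
rewrite nj; exists s; first by rewrite js natr1 ltW.
have hst : state W x u t w <= x + (W t w - W s w) - u * (t - s).
  rewrite (stateE u (@cW w) (@W0 w) x0 t0) Ls.
  have L0 := @regulator0_ge0 _ _ _ W u w (@cW w) (@W0 w) t t0; rewrite Ls in L0.
  by have := x0; case: (leP x (u * s - W s w)) => _; lra.
have e1 : (n - j).+1%:R = n%:R - j%:R + 1 :> R by rewrite -natr1 natrB.
have hu : u * (n - j).+1%:R - 2 * u <= u * (t - s).
  have -> : u * (n - j).+1%:R - 2 * u = u * (n%:R - j%:R - 1) by rewrite e1; ring.
  apply: ler_wpM2l; first exact: ltW.
  by rewrite -natr1 in sj; lra.
have h1 := ler_norm (W t w - W n%:R w).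
have h2 := ler_norm (W n%:R w - W j%:R w).
have h3 := ler_norm (W j%:R w - W s w); rewrite distrC in h3.
apply: le_trans hst _.
apply: (@le_trans _ _ ((x + 2 * u) + `|W t w - W n%:R w| +
   ((`|W n%:R w - W j%:R w| + `|W s w - W j%:R w|) - u * (n - j).+1%:R))).
  lra.
by rewrite lerD2l le_max lexx orbT.
Qed.

(** By [expr_excess_le], a bound for the (2m - r)-th power of the excess over
the drift across the i unit intervals before n: W is compared at n and n - i,
and [chain_sum] accounts for the position inside the interval. *)
Definition gap_bound (m r n i : nat) (w : T) : \bar R :=
  ((2 ^+ m.*2 / (u * i.+1%:R) ^+ r)%:E *
   (((W n%:R w - W (n - i)%:R w) ^+ m.*2)%:E +
    (5 ^+ m.*2)%:E * chain_sum W m (n - i)%:R w))%E.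

(** The maximum over gaps is replaced by a sum, which is measurable and has a
computable expectation. *)
Definition state_bound (m q n : nat) (w : T) : \bar R :=
  ((4 ^+ q)%:E * (((x + 2 * u) ^+ q + 1)%:E +
    (5 ^+ m.*2)%:E * chain_sum W m n%:R w +
    \sum_(0 <= i < n.+1) gap_bound m (m.*2 - q) n i w))%E.

Lemma gap_bound_ge0 m r n i w : (0 <= gap_bound m r n i w)%E.
Proof.
apply: mule_ge0.
  by rewrite lee_fin divr_ge0// ?exprn_ge0// mulr_ge0// ltW.
apply: adde_ge0; first by rewrite lee_fin exprn_even_ge0// odd_double.
by apply: mule_ge0; rewrite ?chain_sum_ge0// lee_fin exprn_ge0.
Qed.

Lemma state_bound_ge0 m q n w : (0 <= state_bound m q n w)%E.
Proof.
apply: mule_ge0; first by rewrite lee_fin exprn_ge0.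
apply: adde_ge0; last by apply: sume_ge0 => i _; exact: gap_bound_ge0.
apply: adde_ge0.
  by rewrite lee_fin addr_ge0// exprn_ge0// addr_ge0// mulr_ge0// ltW.
by apply: mule_ge0; rewrite ?chain_sum_ge0// lee_fin exprn_ge0.
Qed.

Lemma measurable_gap_bound m r n i : measurable_fun setT (gap_bound m r n i).
Proof.
apply: emeasurable_funM => //; apply: emeasurable_funD.
  by apply/measurable_EFinP; apply: measurable_funX; exact: measurable_funB.
by apply: emeasurable_funM => //; exact: measurable_chain_sum.
Qed.

Lemma measurable_state_bound m q n : measurable_fun setT (state_bound m q n).
Proof.
apply: emeasurable_funM => //; apply: emeasurable_funD.
  apply: emeasurable_funD => //.
  by apply: emeasurable_funM => //; exact: measurable_chain_sum.
by apply: emeasurable_sum => i; exact: measurable_gap_bound.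
Qed.

Lemma state_pow_le_bound m q n (t : R) w : (0 < m)%N -> (0 < q <= m.*2)%N ->
  n%:R <= t < n.+1%:R -> ((state W x u t w ^+ q)%:E <= state_bound m q n w)%E.
Proof.
move=> m0 /andP[q0 qm] nt.
have [i lein [s sj hst]] := fbm_state_le_gaps w nt.
have t0 : 0 <= t by case/andP: nt => + _; apply: le_trans.
set o : R := `|W t w - W n%:R w| in hst *.
set a1 : R := `|W n%:R w - W (n - i)%:R w| in hst *.
set a2 : R := `|W s w - W (n - i)%:R w| in hst *.
set b := u * i.+1%:R in hst *.
have o0 : 0 <= o by exact: normr_ge0.
have a10 : 0 <= a1 by exact: normr_ge0.
have a20 : 0 <= a2 by exact: normr_ge0.
have e0 : 0 <= Num.max 0 (a1 + a2 - b) by rewrite le_max lexx.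
have even_norm (y : R) : y ^+ m.*2 = `|y| ^+ m.*2.
  by rewrite -normrX ger0_norm// exprn_even_ge0// odd_double.
have ho : ((o ^+ m.*2)%:E <= (5 ^+ m.*2)%:E * chain_sum W m n%:R w)%E.
  rewrite /o -even_norm; apply: oscillation_le_chain_sum => //.
  by case/andP: nt => -> /ltW; rewrite -natr1.
have ha2 : ((a2 ^+ m.*2)%:E <= (5 ^+ m.*2)%:E * chain_sum W m (n - i)%:R w)%E.
  by rewrite /a2 -even_norm; apply: oscillation_le_chain_sum.
have b0 : 0 < b by rewrite mulr_gt0.
have A0 : 0 <= x + 2 * u by rewrite addr_ge0// mulr_ge0// ltW.
apply: (@le_trans _ _ (4 ^+ q * (((x + 2 * u) ^+ q + 1) + o ^+ m.*2 +
   2 ^+ m.*2 / b ^+ (m.*2 - q) * (a1 ^+ m.*2 + a2 ^+ m.*2)))%:E).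
  rewrite lee_fin.
  apply: le_trans (_ : ((x + 2 * u) + o + Num.max 0 (a1 + a2 - b)) ^+ q <= _).
    apply: lerXn2r => //; rewrite nnegrE ?fbm_state_ge0//.
    by apply: addr_ge0 => //; exact: addr_ge0.
  apply: le_trans (exprD3_le _ _ _ _) _ => //.
  apply: ler_wpM2l; first exact: exprn_ge0.
  apply: lerD.
    by rewrite -addrA lerD2l; exact: expr_le_1D.
  apply: le_trans (expr_excess_le (m.*2 - q) _ _ _) _ => //; first exact: addr_ge0.
  rewrite subnKC// [leRHS]mulrAC.
  apply: ler_wpM2r; first by rewrite invr_ge0 exprn_ge0// ltW.
  exact: exprD2_le.
rewrite EFinM; apply: lee_wpmul2l; first by rewrite lee_fin exprn_ge0.
rewrite EFinD; apply: leeD.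
  by rewrite EFinD; apply: leeD.
rewrite (bigD1_seq i) ?mem_index_iota ?iota_uniq ?ltnS//=.
apply: le_trans (_ : gap_bound m (m.*2 - q) n i w <= _)%E; last first.
  by rewrite leeDl//; apply: sume_ge0 => j _; exact: gap_bound_ge0.
rewrite /gap_bound EFinM; apply: lee_wpmul2l.
  by rewrite lee_fin divr_ge0 ?exprn_ge0// ltW.
by rewrite EFinD; apply: leeD => //; rewrite /a1 -even_norm.
Qed.

(** The exponent m is chosen so that the 2m-th moment of an increment over i
units is at most a multiple of i^(2m - q - 8).  Division by (i + 1)^(2m - q)
leaves a summable remainder. *)
Lemma expectation_state_bound_le q : (0 < q)%N -> exists2 m,
  (0 < m)%N && (q <= m.*2)%N & exists2 c : R, 0 <= c & forall n,
    (\int[P]_w state_bound m q n w <= c%:E)%E.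
Proof.
(* The surplus 8 provides the summability in i and also m >= 6, which the
   chaining bound requires. *)
move=> q0; have [m km hm] := powR_large_le hH1 (q + 8).
have m6 : (6 <= m)%N by lia.
have [cV cV0 hV] := expectation_chain_sum_le hH hW m6.
have [cI cI0 hI] := fbm_increment_moment hH hW m.
have qm2 : (q + 8 <= m.*2)%N by apply: leq_trans km _; rewrite -addnn leq_addr.
exists m; first by lia.
set r := (m.*2 - q)%N.
have r2 : (2 <= r)%N by rewrite /r leq_subRL; lia.
pose D : R := 2 ^+ m.*2 / u ^+ r * (cI + 5 ^+ m.*2 * cV).
have D0 : 0 <= D.
  by rewrite mulr_ge0 ?divr_ge0 ?addr_ge0 ?mulr_ge0 ?exprn_ge0// ltW.
exists (4 ^+ q * ((x + 2 * u) ^+ q + 1 + 5 ^+ m.*2 * cV + D * 2)).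
  apply: mulr_ge0; first exact: exprn_ge0.
  apply: addr_ge0; last exact: mulr_ge0.
  apply: addr_ge0; last by rewrite mulr_ge0// exprn_ge0.
  by rewrite addr_ge0// exprn_ge0// addr_ge0// mulr_ge0// ltW.
move=> n.
have gap_le i : (i <= n)%N ->
    (\int[P]_w gap_bound m r n i w <= (D * i.+1%:R ^- 2)%:E)%E.
  move=> lein; rewrite ge0_integralZl//; first last.
  - by rewrite lee_fin divr_ge0 ?exprn_ge0 ?mulr_ge0// ltW.
  - move=> w _; apply: adde_ge0.
      by rewrite lee_fin exprn_even_ge0// odd_double.
    by apply: mule_ge0; rewrite ?chain_sum_ge0// lee_fin exprn_ge0.
  - apply: emeasurable_funD.
      by apply/measurable_EFinP; apply: measurable_funX; exact: measurable_funB.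
    by apply: emeasurable_funM => //; exact: measurable_chain_sum.
  have i1 : (0 : R) < i.+1%:R by [].
  have ir : (1 : R) <= i.+1%:R ^+ (r - 2) by rewrite exprn_ege1// ler1n.
  have inc : (\int[P]_w ((W n%:R w - W (n - i)%:R w) ^+ m.*2)%:E <=
      (cI * i.+1%:R ^+ (r - 2))%:E)%E.
    case: (posnP i) => [i00|ipos].
      have m20 : (m.*2 == 0)%N = false by lia.
      rewrite integral0_eq; first by rewrite lee_fin mulr_ge0// exprn_ge0.
      by move=> w _; rewrite i00 subn0 subrr expr0n m20.
    have -> : n%:R = i%:R + (n - i)%:R :> R by rewrite -natrD subnKC.
    apply: le_trans (hI _ _ _ _) _ => //; first by rewrite ltr0n.
    rewrite lee_fin; apply: ler_wpM2l => //.
    have i1' : (1 : R) <= i%:R by rewrite ler1n.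
    have e : i%:R ^+ m.*2 = i%:R ^+ (m.*2 - (q + 8)) * i%:R ^+ (q + 8) :> R.
      by rewrite -exprD subnK.
    have := hm _ i1'; rewrite e.
    rewrite ler_pM2r ?exprn_gt0 ?ltr0n// => /le_trans; apply.
    apply: (@le_trans _ _ (i%:R ^+ (r - 2))).
      by apply: ler_weXn2l => //; rewrite /r; lia.
    by apply: lerXn2r; rewrite ?nnegrE// ler_nat.
  rewrite ge0_integralD//; first last.
  - by apply: emeasurable_funM => //; exact: measurable_chain_sum.
  - by move=> w _; apply: mule_ge0; rewrite ?chain_sum_ge0// lee_fin exprn_ge0.
  - by apply/measurable_EFinP; apply: measurable_funX; exact: measurable_funB.
  - by move=> w _; rewrite lee_fin exprn_even_ge0// odd_double.
  rewrite ge0_integralZl//; first last.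
  - by move=> w _; exact: chain_sum_ge0.
  - exact: measurable_chain_sum.
  apply: (@le_trans _ _ ((2 ^+ m.*2 / (u * i.+1%:R) ^+ r)%:E *
     ((cI * i.+1%:R ^+ (r - 2))%:E + (5 ^+ m.*2)%:E * (cV * i.+1%:R ^+ (r - 2))%:E))%E).
    apply: lee_wpmul2l; first by rewrite lee_fin divr_ge0 ?exprn_ge0 ?mulr_ge0// ltW.
    apply: leeD => //; apply: lee_wpmul2l; first by rewrite lee_fin exprn_ge0.
    apply: le_trans (hV _ _) _ => //.
    by rewrite lee_fin ler_peMr.
  rewrite -[((5 ^+ m.*2)%:E * _)%E]EFinM -EFinD -EFinM lee_fin.
  have e : i.+1%:R ^+ r = i.+1%:R ^+ 2 * i.+1%:R ^+ (r - 2) :> R.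
    by rewrite -exprD subnKC.
  rewrite exprMn e /D; set y : R := i.+1%:R ^+ (r - 2) in ir *.
  rewrite [leLHS](_ : _ = 2 ^+ m.*2 / u ^+ r * (cI + 5 ^+ m.*2 * cV) * i.+1%:R ^- 2) //.
  have y0 : y != 0 by rewrite gt_eqF// (lt_le_trans _ ir).
  have u0' : u ^+ r != 0 by rewrite expf_neq0// gt_eqF.
  have gen (a' v z y' c1 c2 c3 : R) : v != 0 -> z != 0 -> y' != 0 ->
      a' / (v * (z * y')) * (c1 * y' + c3 * (c2 * y')) = a' / v * (c1 + c3 * c2) / z.
    by move=> v0 z0 y0'; field; rewrite v0 z0 y0'.
  by apply: gen => //; rewrite expf_neq0// pnatr_eq0.
pose C0 : T -> \bar R := cst ((x + 2 * u) ^+ q + 1)%:E.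
pose C1 w := ((5 ^+ m.*2)%:E * chain_sum W m n%:R w)%E.
pose C2 w := (\sum_(0 <= i < n.+1) gap_bound m r n i w)%E.
have C00 w : (0 <= C0 w)%E.
  by rewrite lee_fin addr_ge0// exprn_ge0// addr_ge0// mulr_ge0// ltW.
have C10 w : (0 <= C1 w)%E.
  by apply: mule_ge0; rewrite ?chain_sum_ge0// lee_fin exprn_ge0.
have C20 w : (0 <= C2 w)%E by apply: sume_ge0 => i _; exact: gap_bound_ge0.
have mC1 : measurable_fun setT C1.
  by apply: emeasurable_funM => //; exact: measurable_chain_sum.
have mC2 : measurable_fun setT C2.
  by apply: emeasurable_sum => i; exact: measurable_gap_bound.
have mC01 : measurable_fun setT (fun w => C0 w + C1 w)%E.
  by apply: emeasurable_funD => //; exact: measurable_cst.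
rewrite (_ : state_bound m q n = fun w => ((4 ^+ q)%:E * (C0 w + C1 w + C2 w))%E)//.
rewrite ge0_integralZl//; first last.
- by move=> w _; apply: adde_ge0 => //; exact: adde_ge0.
- exact: emeasurable_funD.
rewrite EFinM; apply: lee_wpmul2l; first by rewrite lee_fin exprn_ge0.
rewrite ge0_integralD//; last by move=> w _; exact: adde_ge0.
rewrite EFinD; apply: leeD.
  rewrite ge0_integralD//.
  rewrite EFinD; apply: leeD.
    by rewrite integral_cst//= probability_setT mule1.
  rewrite ge0_integralZl//; first last.
  - by move=> w _; exact: chain_sum_ge0.
  - exact: measurable_chain_sum.
  by rewrite EFinM; apply: lee_wpmul2l; [rewrite lee_fin exprn_ge0|exact: hV].
rewrite ge0_integral_sum//; first last.
- by move=> i w _; exact: gap_bound_ge0.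
- by move=> i; exact: measurable_gap_bound.
apply: (@le_trans _ _ (\sum_(0 <= i < n.+1) (D * i.+1%:R ^- 2)%:E)%E).
  by rewrite big_nat [leRHS]big_nat; apply: lee_sum => i /andP[_]; exact: gap_le.
rewrite sumEFin lee_fin -mulr_sumr; apply: ler_wpM2l => //.
exact: sum_inv_sqr_le.
Qed.

End state_moments.

(** * Rapidly decreasing tails *)

Section tails.
Context {d : measure_display} {T : measurableType d} {R : realType}.
Variables (P : probability T R) (H : R).
Hypotheses (hH : 2^-1 <= H) (hH1 : H < 1).
Variable W : R -> {RV P >-> R}.
Hypothesis hW : fractional_brownian_motion H W.
Variable u : R.
Hypothesis u0 : 0 < u.

Lemma measurable_set_ge (f : T -> R) (a : R) : measurable_fun setT f ->
  measurable [set w | a <= f w].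
Proof.
move=> mf; have -> : [set w | a <= f w] = setT `&` f @^-1` `[a, +oo[.
  by rewrite setTI; apply/seteqP; split => w /=; rewrite in_itv/= andbT.
exact: mf.
Qed.

Lemma measurable_set_gt (f g : T -> R) : measurable_fun setT f ->
  measurable_fun setT g -> measurable [set w | f w < g w].
Proof.
move=> mf mg; have -> : [set w | f w < g w] = setT `&` (g \- f) @^-1` `]0, +oo[.
  by rewrite setTI; apply/seteqP; split => w /=; rewrite in_itv/= andbT subr_gt0.
exact: measurable_funB.
Qed.

(** Being closed under maxima and satisfied by constants, this class contains
the threshold max(x, X*(0)) of the coupling argument. *)
Definition rapid_tail (xi : T -> R) := forall k : nat, exists2 c : R, 0 <= c &
  forall a, 0 < a -> (P [set w | (a <= xi w)%R] <= (c / a ^+ k)%:E)%E.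

Lemma rapid_tail_cst (x : R) : 0 <= x -> rapid_tail (cst x).
Proof.
move=> x0 k; exists (x ^+ k) => [|a a0]; first exact: exprn_ge0.
case: (lerP a x) => [ax|xa].
  apply: (@le_trans _ _ 1%E).
    rewrite (_ : [set _ | true] = setT) ?probability_setT//.
    by apply/seteqP; split.
  rewrite lee_fin ler_pdivlMr ?exprn_gt0// mul1r.
  by apply: lerXn2r => //; rewrite nnegrE// ltW.
rewrite (_ : [set w | _] = set0).
  by rewrite measure0 lee_fin divr_ge0 ?exprn_ge0// ltW.
by apply/seteqP; split => w //=; rewrite leNgt xa.
Qed.

Lemma rapid_tail_max (xi zeta : T -> R) : measurable_fun setT xi ->
  measurable_fun setT zeta -> rapid_tail xi -> rapid_tail zeta ->
  rapid_tail (fun w => Num.max (xi w) (zeta w)).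
Proof.
move=> mxi mzeta txi tzeta k.
have [c c0 hc] := txi k; have [c' c'0 hc'] := tzeta k.
exists (c + c') => [|a a0]; first exact: addr_ge0.
rewrite mulrDl EFinD; apply: le_trans (leeD (hc _ a0) (hc' _ a0)).
rewrite (_ : [set w | _] = [set w | a <= xi w] `|` [set w | a <= zeta w]).
  by apply: measureU2; exact: measurable_set_ge.
by apply/seteqP; split => w /=; rewrite le_max => /orP.
Qed.

(** Markov's inequality for a moment high enough to gain the power n^k. *)
Lemma fbm_linear_tail k : exists2 c : R, 0 <= c & forall n : nat, (0 < n)%N ->
  (P [set w | (u * n%:R / 2 <= W n%:R w)%R] <= (c * n%:R ^- k)%:E)%E.
Proof.
have [m km hm] := powR_large_le hH1 k.
have [c c0 hc] := fbm_increment_moment hH hW m.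
exists (c / (u / 2) ^+ m.*2) => [|n n0].
  by rewrite divr_ge0 ?exprn_ge0// divr_ge0// ltW.
have n0' : (0 : R) < n%:R by rewrite ltr0n.
set b := u * n%:R / 2.
have b0 : 0 < b by rewrite divr_gt0 ?mulr_gt0.
have mA : measurable [set w | b <= W n%:R w] by exact: measurable_set_ge.
have := @markov_ge _ _ _ P (fun w => (W n%:R w ^+ m.*2)%:E)
  [set w | b <= W n%:R w] (b ^+ m.*2) mA (exprn_ge0 _ (ltW b0)).
have even0 (y : R) : 0 <= y ^+ m.*2 by rewrite exprn_even_ge0// odd_double.
move=> /(_ (fun w => even0 _)) h1.
have {h1} h1 : ((b ^+ m.*2)%:E * P [set w | (b <= W n%:R w)%R] <=
    (c * (n%:R `^ H) ^+ m.*2)%:E)%E.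
  apply: le_trans (h1 _) _ => [w /= bw|].
    rewrite lee_fin; apply: lerXn2r => //; rewrite nnegrE ?(ltW b0)//.
    exact: le_trans (ltW b0) bw.
  have := hc 0 n%:R (lexx _) n0'; rewrite addr0; apply: le_trans.
  by under [leRHS]eq_integral do rewrite (fbm_start hW) subr0.
have n1 : (1 : R) <= n%:R by rewrite ler1n.
have h2 := hm _ n1.
rewrite -(@fineK _ (P _)) ?fin_num_measure// in h1 *.
move: h1; rewrite -EFinM !lee_fin => h1.
set p := fine _ in h1 *.
have p2 : (u / 2) ^+ m.*2 * n%:R ^+ m.*2 * p <= c * (n%:R `^ H) ^+ m.*2.
  by rewrite -exprMn mulrAC.
rewrite !ler_pdivlMr ?exprn_gt0 ?divr_gt0//.
rewrite -(@ler_pM2r _ (n%:R ^+ m.*2)) ?exprn_gt0//.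
have -> : p * n%:R ^+ k * (u / 2) ^+ m.*2 * n%:R ^+ m.*2 =
  ((u / 2) ^+ m.*2 * n%:R ^+ m.*2 * p) * n%:R ^+ k by ring.
apply: (@le_trans _ _ (c * (n%:R `^ H) ^+ m.*2 * n%:R ^+ k)).
  by apply: ler_wpM2r => //; rewrite exprn_ge0// ltW.
by rewrite -mulrA; apply: ler_wpM2l.
Qed.

(** If un - W(n) < xi, then W(n) or xi is at least un / 2. *)
Lemma uncoupled_probability_le (xi : T -> R) k : measurable_fun setT xi ->
  rapid_tail xi -> exists2 c : R, 0 <= c & forall n : nat,
  (P [set w | (u * n%:R - W n%:R w < xi w)%R] <= (c * n.+1%:R ^- k)%:E)%E.
Proof.
move=> mxi txi; have [c c0 hc] := txi k; have [c' c'0 hc'] := fbm_linear_tail k.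
pose D := c / (u / 2) ^+ k + c'.
have D0 : 0 <= D by rewrite addr_ge0// divr_ge0 ?exprn_ge0 ?divr_ge0// ltW.
exists (1 + D * 2 ^+ k) => [|n]; first by rewrite addr_ge0// mulr_ge0// exprn_ge0.
have mA : measurable [set w | u * n%:R - W n%:R w < xi w].
  by apply: measurable_set_gt => //; exact: measurable_funB.
case: (posnP n) => [->|n0].
  apply: le_trans (probability_le1 _ _) _.
    by apply: measurable_set_gt => //; exact: measurable_funB.
  rewrite lee_fin expr1n invr1 mulr1 lerDl mulr_ge0// exprn_ge0//.
have n0' : (0 : R) < n%:R by rewrite ltr0n.
have un0 : 0 < u * n%:R / 2 by rewrite divr_gt0 ?mulr_gt0.
apply: (@le_trans _ _ (P ([set w | u * n%:R / 2 <= xi w] `|`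
    [set w | u * n%:R / 2 <= W n%:R w]))).
  apply: le_measure; rewrite ?inE//.
    by apply: measurableU; exact: measurable_set_ge.
  move=> w /= hw; case: (leP (u * n%:R / 2) (xi w)) => h1; first by left.
  by right; lra.
apply: le_trans (measureU2 _ _ _) _; try exact: measurable_set_ge.
apply: le_trans (leeD (hc _ un0) (hc' _ n0)) _.
rewrite -EFinD lee_fin.
have -> : c / (u * n%:R / 2) ^+ k + c' / n%:R ^+ k = D / n%:R ^+ k.
  by rewrite /D mulrDl mulrAC exprMn invfM mulrA.
apply: (@le_trans _ _ (D * 2 ^+ k / n.+1%:R ^+ k)); last first.
  rewrite ler_wpM2r ?lerDr// invr_ge0 exprn_ge0//.
rewrite -mulrA ler_wpM2l// ler_pdivlMr ?exprn_gt0// mulrC ler_pdivrMr ?exprn_gt0//.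
rewrite -exprMn; apply: lerXn2r; rewrite ?nnegrE ?mulr_ge0//.
by rewrite -natrM ler_nat; lia.
Qed.

Section stationary_start.
Variable Xs : R -> {RV P >-> R}.
Hypothesis Xs_dynamics : forall (t : R) (w : T), 0 <= t ->
  Xs t w = W t w - u * t + Num.max (Xs 0 w) (regulator W 0 u t w).
Hypothesis Xs_law : forall t : R, 0 <= t ->
  same_law P (fun w => (Xs t w)%:E) (all_time_max W u).

Let cW w : {within `[0, +oo[, continuous (W ^~ w)}.
Proof. exact: (fbm_continuous hW). Qed.

Let W0 w : W 0 w = 0.
Proof. exact: (fbm_start hW). Qed.

(** All the variables X*(t) share the law of the all-time maximum. *)
Lemma stationary_tail_const (a t : R) : 0 <= t ->
  P [set w | a <= Xs t w] = P [set w | a <= Xs 0 w].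
Proof.
move=> t0.
have mA : measurable (`[a%:E, +oo[%classic : set (\bar R)) by exact: emeasurable_itv.
have e (s : R) : [set w | a <= Xs s w] = (fun w => (Xs s w)%:E) @^-1` `[a%:E, +oo[.
  by apply/seteqP; split => w /=; rewrite in_itv/= andbT lee_fin.
by rewrite !e !Xs_law.
Qed.

Lemma probability_ge_cvg0 (X : {RV P >-> R}) (e : R) : 0 < e ->
  exists r : R, forall a, r < a -> (P [set w | (a <= X w)%R] <= e%:E)%E.
Proof.
move=> e0; have /fine_cvgP[_ /cvgrPdist_lt /(_ _ e0)] := cvg_ccdfy0 X.
move=> [r [_ hr]]; exists (r + 1) => a ra.
have ra1 : r < a - 1 by lra.
have /= := hr _ ra1; rewrite sub0r normrN.
have ccE : ccdf X (a - 1) = P [set w | (a - 1 < X w)%R].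
  rewrite /ccdf /distribution /pushforward; congr (P _).
  by apply/seteqP; split => w /=; rewrite in_itv/= andbT.
have mB : measurable [set w | a - 1 < X w].
  by apply: measurable_set_gt => //; exact: measurable_cst.
rewrite ger0_norm; last by apply: fine_ge0; rewrite ccE.
move=> h; apply: (@le_trans _ _ (ccdf X (a - 1))).
  rewrite ccE; apply: le_measure; rewrite ?inE//.
    exact: measurable_set_ge.
  by move=> w /= aw; apply: lt_le_trans aw; rewrite ltrBlDr ltrDl.
by rewrite -(@fineK _ (ccdf _ _)) ?lee_fin ?(ltW h)// ccE fin_num_measure.
Qed.

(** Compare X*(0) with X*(n) for n large.  Either L(n) >= X*(0), and then X*(n)
is the state started from 0, whose moments are bounded uniformly in n; or
X*(0) > L(n) >= un - W(n), which has small probability. *)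
Lemma stationary_rapid_tail : rapid_tail (Xs 0).
Proof.
case=> [|k].
  exists 1 => // a a0; rewrite expr0 divr1.
  by apply: probability_le1; exact: measurable_set_ge.
have [m /andP[m0 km] [c c0 hc]] :=
  expectation_state_bound_le hH hH1 hW u0 (lexx 0) (ltn0Sn k).
exists c => // a a0; apply/lee_addgt0Pr => e e0.
have e20 : 0 < e / 2 by rewrite divr_gt0.
have [r hr] := probability_ge_cvg0 (Xs 0) e20.
have [c' c'0 hc'] := fbm_linear_tail 1.
(* Large enough for both exceptional events to have probability at most e/2. *)
pose n := (maxn (Num.truncn (2 * r / u)) (Num.truncn (2 * c' / e))).+1.
have nr : r < u * n%:R / 2.
  have : 2 * r / u < n%:R.
    by apply: lt_le_trans (truncnS_gt _) _; rewrite ler_nat ltnS leq_maxl.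
  by rewrite ltr_pdivrMr// ltr_pdivlMr// [n%:R * u]mulrC [2 * r]mulrC.
have ne : c' / n%:R <= e / 2.
  have : 2 * c' / e <= n%:R.
    by apply: le_trans (ltW (truncnS_gt _)) _; rewrite ler_nat ltnS leq_maxr.
  rewrite ler_pdivrMr// => h; rewrite ler_pdivrMr//; lra.
rewrite -(@stationary_tail_const a n%:R)//.
pose E := [set w | ((a ^+ k.+1)%:E <= state_bound W u 0 m k.+1 n w)%E].
have mE : measurable E.
  rewrite /E -[X in measurable X]setTI; apply: emeasurable_fun_c_infty => //.
  exact: measurable_state_bound.
pose F := [set w | u * n%:R / 2 <= Xs 0 w].
pose G := [set w | u * n%:R / 2 <= W n%:R w].
have mF : measurable F by exact: measurable_set_ge.
have mG : measurable G by exact: measurable_set_ge.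
have n0 : (0 : R) <= n%:R by [].
apply: (@le_trans _ _ (P (E `|` (F `|` G)))).
  apply: le_measure; rewrite ?inE//.
  - exact: measurable_set_ge.
  - by apply: measurableU => //; exact: measurableU.
  move=> w /= aX; rewrite Xs_dynamics// in aX.
  have Lge : u * n%:R - W n%:R w <= regulator W 0 u n%:R w.
    by apply: regulator0_ge (@cW w) _ _ _; rewrite n0 lexx.
  move: aX; case: (leP (Xs 0 w) (regulator W 0 u n%:R w)) => XL aX.
    left; have := @state_pow_le_bound _ _ _ P H W hW u 0 u0 (lexx 0) m k.+1 n n%:R w m0.
    rewrite km/= lexx ltr_nat ltnSn => /(_ isT isT); apply: le_trans.
    rewrite lee_fin; apply: lerXn2r; rewrite ?nnegrE ?(ltW a0)//.
      by apply: (fbm_state_ge0 hW).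
    rewrite (stateE u (@cW w) (@W0 w) (lexx 0) n0) max_r//.
    exact: (@regulator0_ge0 _ _ _ W u w (@cW w) (@W0 w) _ n0).
  right; case: (leP (u * n%:R / 2) (Xs 0 w)) => h1; first by left.
  by right; rewrite /G/=; lra.
apply: le_trans (measureU2 _ mE (measurableU _ _ mF mG)) _.
apply: leeD.
  have ak : 0 < a ^+ k.+1 by rewrite exprn_gt0.
  have B0 w : (0 <= state_bound W u 0 m k.+1 n w)%E by exact: state_bound_ge0.
  have := @markov_ge _ _ _ P (state_bound W u 0 m k.+1 n) E (a ^+ k.+1) mE (ltW ak)
    B0 (fun w h => h).
  move=> /le_trans /(_ (hc n)) h.
  have [pE hpE] : exists r' : R, P E = r'%:E.
    by exists (fine (P E)); rewrite fineK// fin_num_measure.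
  suff : (pE%:E <= (c / a ^+ k.+1)%:E)%E by rewrite -hpE.
  by move: h; rewrite hpE -EFinM !lee_fin [_ * pE]mulrC ler_pdivlMr.
apply: le_trans (measureU2 _ mF mG) _.
rewrite [e]splitr EFinD; apply: leeD; first exact: hr.
by apply: le_trans (hc' _ _) _ => //; rewrite expr1 lee_fin.
Qed.

End stationary_start.

End tails.

(** * The coupling time *)

Section coupling_time.
Context {d : measure_display} {T : measurableType d} {R : realType}.
Variables (P : probability T R) (H : R).
Hypotheses (hH : 2^-1 <= H) (hH1 : H < 1).
Variable W : R -> {RV P >-> R}.
Hypothesis hW : fractional_brownian_motion H W.
Variable u : R.
Hypothesis u0 : 0 < u.

(** The regulator at time n is at least un - W(n), so outside this event a path
started from xi has already been pushed up by the boundary. *)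
Definition uncoupled (xi : T -> R) (n : nat) : set T :=
  [set w | u * n%:R - W n%:R w < xi w].

Lemma measurable_uncoupled (xi : T -> R) n : measurable_fun setT xi ->
  measurable (uncoupled xi n).
Proof. by move=> mxi; apply: measurable_set_gt => //; exact: measurable_funB. Qed.

Lemma uncoupled_series_le (xi : T -> R) k : measurable_fun setT xi ->
  rapid_tail P xi -> exists2 c : R, 0 <= c &
  (\sum_(n <oo) (n.+1%:R ^+ k)%:E * P (uncoupled xi n) <= c%:E)%E.
Proof.
move=> mxi txi.
have [c c0 hc] := uncoupled_probability_le hH hH1 hW u0 k.+2 mxi txi.
exists (c * 2) => [|]; first exact: mulr_ge0.
apply: nneseries_le_bound => [n|N].
  by rewrite mule_ge0// lee_fin exprn_ge0.
apply: (@le_trans _ _ (\sum_(0 <= n < N) (c * n.+1%:R ^- 2)%:E)%E); last first.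
  by rewrite sumEFin lee_fin -mulr_sumr ler_wpM2l// sum_inv_sqr_le.
apply: lee_sum => n _.
apply: le_trans (lee_wpmul2l _ (hc n)) _; first by rewrite lee_fin exprn_ge0.
rewrite -EFinM lee_fin mulrCA ler_wpM2l//.
by rewrite -addn2 exprD invfM mulrA mulfV ?mul1r// expf_neq0// pnatr_eq0.
Qed.

Lemma uncoupled_integral_series (xi : T -> R) k : measurable_fun setT xi ->
  (\int[P]_w (\sum_(n <oo) (n.+1%:R ^+ k * \1_(uncoupled xi n) w)%:E) =
   \sum_(n <oo) (n.+1%:R ^+ k)%:E * P (uncoupled xi n))%E.
Proof.
move=> mxi; rewrite integral_nneseries//; first last.
  move=> n; apply/measurable_EFinP; apply: measurable_funM => //.
  by apply: measurable_indic; exact: measurable_uncoupled.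
apply: eq_eseriesr => n _.
under eq_integral do rewrite EFinM.
rewrite ge0_integralZl//; first last.
- by apply/measurable_EFinP; apply: measurable_indic; exact: measurable_uncoupled.
by rewrite integral_indic//= ?setIT//; exact: measurable_uncoupled.
Qed.

Variable Xs : R -> {RV P >-> R}.
Hypothesis Xs_dynamics : forall (t : R) (w : T), 0 <= t ->
  Xs t w = W t w - u * t + Num.max (Xs 0 w) (regulator W 0 u t w).
Variable x : R.
Hypothesis x0 : 0 <= x.

Let cW w : {within `[0, +oo[, continuous (W ^~ w)}.
Proof. exact: (fbm_continuous hW). Qed.

Let W0 w : W 0 w = 0.
Proof. exact: (fbm_start hW). Qed.

(** Restricting to integer times makes the event of being coupled by time t an
equality of two values at the integer part of t, and turns moments into sums. *)
Definition coupling_time (w : T) : \bar R :=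
  ereal_inf [set n%:R%:E | n in [set n : nat | state W x u n%:R w = Xs n%:R w]].

Lemma coupled_homo (s t : R) w : 0 <= s -> s <= t ->
  state W x u s w = Xs s w -> state W x u t w = Xs t w.
Proof.
move=> s0 st; have t0 := le_trans s0 st.
rewrite !(stateE u (@cW w) (@W0 w) x0)// (Xs_dynamics _ s0) (Xs_dynamics _ t0) => /addrI h.
congr (_ + _).
have L := @regulator0_homo _ _ _ W u w (@cW w) (@W0 w) s t s0 st.
move: h L; set l := regulator _ _ _ s _; set l' := regulator _ _ _ t _.
by case: (leP x l); case: (leP (Xs 0 w) l); case: (leP x l');
  case: (leP (Xs 0 w) l'); lra.
Qed.

Lemma not_coupled_uncoupled (n : nat) w : state W x u n%:R w != Xs n%:R w ->
  uncoupled (fun w => Num.max x (Xs 0 w)) n w.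
Proof.
move=> neq; rewrite /uncoupled/= ltNge; apply: contra neq; rewrite ge_max.
move=> /andP[h1 h2]; apply/eqP; have n0 : (0 : R) <= n%:R by [].
have Lge : u * n%:R - W n%:R w <= regulator W 0 u n%:R w.
  by apply: (@regulator0_ge _ _ _ W u w (@cW w)); rewrite n0 lexx.
rewrite (stateE u (@cW w) (@W0 w) x0)// (Xs_dynamics _ n0).
by rewrite !max_r// (le_trans _ Lge).
Qed.

Lemma coupling_time_leP (t : R) w : 0 <= t ->
  (coupling_time w <= t%:E)%E <->
  state W x u (Num.truncn t)%:R w = Xs (Num.truncn t)%:R w.
Proof.
move=> t0; have /andP[tt1 tt2] := truncn_itv t0; split=> [|h].
  apply: contraPP => /eqP h; apply/negP; rewrite -ltNge.
  apply: (@lt_le_trans _ _ (Num.truncn t).+1%:R%:E); first by rewrite lte_fin.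
  apply: le_ereal_inf_tmp => _ [n /= hn <-]; rewrite lee_fin ler_nat ltnNge.
  apply: contra h => nt; apply/eqP; apply: coupled_homo hn => //.
  by rewrite ler_nat.
apply: (@le_trans _ _ (Num.truncn t)%:R%:E); last by rewrite lee_fin.
by apply: ereal_inf_lbound; exists (Num.truncn t).
Qed.

Lemma coupling_time_ge0 w : (0 <= coupling_time w)%E.
Proof. by apply: le_ereal_inf_tmp => _ [n _ <-]; rewrite lee_fin. Qed.

(** Agreement persists once reached, so being coupled by time t means agreement
at the integer part of t, a comparison of two variables observed by time t. *)
Lemma coupling_time_stopping :
  stopping_time (generated_filtration (state W x u) Xs) coupling_time.
Proof.
split=> [|t t0]; first exact: coupling_time_ge0.
have /andP[tt1 tt2] := truncn_itv t0.
set s : R := (Num.truncn t)%:R in tt1.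
have -> : [set w | (coupling_time w <= t%:E)%E] = [set w | state W x u s w = Xs s w].
  by apply/seteqP; split => w /= /(coupling_time_leP w t0).
rewrite /generated_filtration; set G := \bigcup_(_ in _) _.
have st : s \in `[0, t] by rewrite in_itv/= tt1 andbT.
pose f : g_sigma_algebraType G -> R := state W x u s.
pose g : g_sigma_algebraType G -> R := Xs s.
have mf : measurable_fun setT f.
  move=> _ B mB; apply: sub_sigma_algebra; exists s => //; left.
  by exists B.
have mg : measurable_fun setT g.
  move=> _ B mB; apply: sub_sigma_algebra; exists s => //; right.
  by exists B.
have mlt := measurable_set_gt mf mg; have mgt := measurable_set_gt mg mf.
have := measurableC (measurableU _ _ mlt mgt).
rewrite (_ : ~` _ = [set w | f w = g w])//.
apply/seteqP; split => w /=.
  by move=> /not_orP[/negP + /negP]; rewrite -!leNgt => h1 h2; apply/eqP; rewrite eq_le h1 h2.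
by move=> ->; rewrite ltxx; case.
Qed.

Hypothesis tail0 : rapid_tail P (Xs 0).

Let xi w := Num.max x (Xs 0 w).

Let mxi : measurable_fun setT xi.
Proof. by apply: measurable_maxr. Qed.

Let txi : rapid_tail P xi.
Proof. by apply: rapid_tail_max => //; exact: rapid_tail_cst. Qed.

(** An infinite coupling time means being uncoupled at every integer. *)
Lemma coupling_time_finite : {ae P, forall w, (coupling_time w < +oo)%E}.
Proof.
have mA : measurable (\bigcap_n uncoupled xi n).
  by apply: bigcapT_measurable => n; exact: measurable_uncoupled.
exists (\bigcap_n uncoupled xi n); split => //.
  apply/eqP; rewrite eq_le measure_ge0 andbT; apply/lee_addgt0Pr => e e0.
  have [c c0 hc] := uncoupled_probability_le hH hH1 hW u0 1 mxi txi.
  pose n := Num.truncn (c / e); rewrite add0e.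
  apply: (@le_trans _ _ (P (uncoupled xi n))).
    by apply: le_measure; rewrite ?inE//; [exact: measurable_uncoupled|exact: bigcap_inf].
  apply: le_trans (hc n) _; rewrite lee_fin expr1 ler_pdivrMr// mulrC.
  by rewrite -ler_pdivrMr// ltW// truncnS_gt.
move=> w /= h n _; apply: not_coupled_uncoupled; apply: contra_notN h => /eqP h.
apply: (@le_lt_trans _ _ n%:R%:E); last exact: ltry.
by apply: ereal_inf_lbound; exists n.
Qed.

(** If the coupling time is N + 1, then time N is uncoupled and the term of
index N is (N + 1)^b; if it is infinite, every term is present and the series
diverges. *)
Lemma coupling_time_moment (beta : R) : 0 <= beta ->
  (\int[P]_w (coupling_time w `^ beta) < +oo)%E.
Proof.
move=> beta0; pose b := (Num.truncn beta).+1.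
have betab : beta <= b%:R by rewrite ltW// truncnS_gt.
pose S w : \bar R := (\sum_(n <oo) (n.+1%:R ^+ b * \1_(uncoupled xi n) w)%:E)%E.
have t0 n w : (0 <= (n.+1%:R ^+ b * \1_(uncoupled xi n) w)%:E :> \bar R)%E.
  by rewrite lee_fin mulr_ge0// exprn_ge0.
have S0 w : (0 <= S w)%E by apply: nneseries_ge0 => n _ _.
have mS : measurable_fun setT S.
  apply: ge0_emeasurable_sum => [n w _ _|n _]; first exact: t0.
  apply/measurable_EFinP; apply: measurable_funM => //.
  by apply: measurable_indic; exact: measurable_uncoupled.
have termS w n : uncoupled xi n w -> ((n.+1%:R ^+ b)%:E <= S w)%E.
  move=> hn; have := nneseries_ge_term n (fun n => t0 n w).
  by rewrite indicE mem_set// mulr1.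
apply: (@le_lt_trans _ _ (\int[P]_w (1 + S w))%E).
  apply: ge0_le_lower_integralT => w; first exact: poweR_ge0.
  have [ex|nex] := pselect (exists n : nat, state W x u n%:R w == Xs n%:R w).
    case: (ex_minnP ex) => N /eqP hN minN.
    have tN : (coupling_time w <= N%:R%:E)%E.
      by apply: ereal_inf_lbound; exists N.
    case: (coupling_time w) (coupling_time_ge0 w) tN => [r||] //=.
    rewrite !lee_fin => r0 rN.
    case: N rN hN minN => [|N] rN hN minN.
      apply: (@le_trans _ _ 1%E); last by rewrite leeDl.
      have r1 : r <= 1 by apply: le_trans rN _.
      have := ge0_ler_powR beta0 _ _ r1; rewrite !nnegrE powR1 => h.
      by rewrite lee_fin h.
    have hU : uncoupled xi N w.
      apply: not_coupled_uncoupled; apply/negP => hN'.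
      by have := minN _ hN'; rewrite ltnn.
    apply: (@le_trans _ _ (N.+1%:R ^+ b)%:E); last first.
      by apply: le_trans (termS _ _ hU) _; rewrite leeDr.
    rewrite lee_fin -powR_mulrn//.
    apply: (@le_trans _ _ (N.+1%:R `^ beta)).
      by apply: ge0_ler_powR => //; rewrite nnegrE.
    by apply: ler_powR => //; rewrite ler1n.
  have hU n : uncoupled xi n w.
    by apply: not_coupled_uncoupled; apply/negP => hn; apply: nex; exists n.
  suff -> : S w = +oo%E by rewrite addey ?leey.
  apply/eqyP => A A0; apply: le_trans (termS _ (Num.truncn A) (hU _)).
  rewrite lee_fin; apply: le_trans (ltW (truncnS_gt _)) _.
  by rewrite -[leLHS]expr1; apply: ler_weXn2l => //; rewrite ler1n.
rewrite ge0_integralD//.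
rewrite integral_cst//= probability_setT mule1 /S uncoupled_integral_series//.
have [c c0 hc] := uncoupled_series_le b mxi txi.
by apply: le_lt_trans (leeD (lexx _) hc) _; rewrite -EFinD ltry.
Qed.

End coupling_time.

(** * Integrals of step functions and limits superior *)

Section step_integral.
Context {R : realType}.
Local Notation mu := (@lebesgue_measure R).
Local Open Scope ereal_scope.

(** The integer part of t indexes the unit interval containing t, and each unit
interval has length 1. *)
Lemma integral_le_step (f f0 : R -> \bar R) (g : nat -> \bar R) (S : R) :
  (forall n, 0 <= g n) ->
  (forall t, (0 <= t <= S)%R -> 0 <= f t) -> (forall t, (0 <= t <= S)%R -> 0 <= f0 t) ->
  (forall t, (0 <= t <= S)%R -> f t <= f0 t + g (Num.truncn t)) ->
  \int[mu]_(t in `[0%R, S]) f t <=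
  \int[mu]_(t in `[0%R, S]) f0 t + \sum_(n <oo) g n.
Proof.
move=> g0 f_0 f00 fg.
pose h n (t : R) : \bar R := g n * (\1_(`[n%:R, n.+1%:R[ : set R) t)%:E.
have h0 n t : 0 <= h n t by rewrite mule_ge0// lee_fin.
have mh n : measurable_fun setT (h n).
  by apply: emeasurable_funM => //; apply/measurable_EFinP; exact: measurable_indic.
apply: (@le_trans _ _ (\int[mu]_(t in `[0%R, S]) (f0 t + \sum_(n <oo) h n t))).
  apply: ge0_le_lower_integral => t /=; rewrite in_itv/= => tS; first exact: f_0.
  apply: le_trans (fg _ tS) _; apply: leeD => //.
  apply: le_trans (nneseries_ge_term (Num.truncn t) (fun n => h0 n t)).
  have t0 : (0 <= t)%R by case/andP: tS.
  by rewrite /h indicE mem_set ?mule1//= in_itv/= truncn_itv.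
have f00' t : `[0%R, S]%classic t -> 0 <= f0 t.
  by rewrite /= in_itv/=; exact: f00.
have s0 t : `[0%R, S]%classic t -> 0 <= \sum_(n <oo) h n t.
  by move=> _; apply: nneseries_ge0 => n _ _.
have ms : measurable_fun `[0%R, S] (fun t => \sum_(n <oo) h n t).
  by apply: ge0_emeasurable_sum => // n _; exact: measurable_funTS.
have mS : measurable (`[0%R, S] : set (measurableTypeR R)) by exact: measurable_itv.
apply: le_trans (lower_integralD_le mu mS f00' s0 ms) _.
apply: leeD => //; rewrite integral_nneseries//; last first.
  by move=> n; apply: measurable_funTS; exact: mh.
apply: lee_nneseries => [n _ _|n _]; first exact: integral_ge0.
apply: (@le_trans _ _ (\int[mu]_t h n t)).
  rewrite integral_mkcond; apply: ge0_le_lower_integralT => t.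
    by apply: erestrict_ge0 => ? _; exact: h0.
  by rewrite patchE; case: ifP.
rewrite /h ge0_integralZl//; last by apply/measurable_EFinP; exact: measurable_indic.
rewrite integral_indic//= setIT lebesgue_measure_itv/= lte_fin ltr_nat ltnSn.
by rewrite -EFinB -natr1 addrAC subrr add0r mule1.
Qed.

End step_integral.

Section limsup_bounds.
Context {R : realType}.
Local Open Scope ereal_scope.

Lemma limf_esup_le_shift (F G : R -> \bar R) (c : R) : (0 <= c)%R ->
  (forall S, (1 <= S)%R -> F S <= G S + (c / S)%:E) ->
  limf_esup F (+oo%R : set_system R) <= limf_esup G (+oo%R : set_system R).
Proof.
move=> c0 FG; rewrite !limf_esupE.
apply: le_ereal_inf_tmp => _ [V [M [Mr VM]] <-].
apply/lee_addgt0Pr => e e0.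
pose M' := Num.max M (Num.max 1 (c / e))%R.
apply: (@le_trans _ _ (ereal_sup (F @` [set S | M' < S]%R))).
  apply: ereal_inf_lbound; exists [set S | M' < S]%R => //.
  by exists M'; split => //; rewrite num_real.
apply: ge_ereal_sup => _ [S /= MS <-].
move: MS; rewrite /M' !gt_max => /andP[MS /andP[S1 Sc]].
apply: le_trans (FG _ (ltW S1)) _; apply: leeD.
  by apply: ereal_sup_ubound; exists S => //; exact: VM.
have S0 : (0 < S)%R by exact: lt_trans S1.
by rewrite lee_fin ler_pdivrMr// mulrC -ler_pdivrMr// ltW.
Qed.


Lemma limf_esup_ge0 (F : R -> \bar R) :
  (forall S, (1 <= S)%R -> 0 <= F S) -> 0 <= limf_esup F (+oo%R : set_system R).
Proof.
move=> F0; rewrite limf_esupE; apply: le_ereal_inf_tmp => _ [V [M [Mr VM]] <-].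
pose S := (Num.max M 1 + 1)%R.
have m1 : (M <= Num.max M 1)%R by rewrite le_max lexx.
have m2 : (1 <= Num.max M 1)%R by rewrite le_max lexx orbT.
have MS : (M < S)%R by rewrite /S; lra.
have S1 : (1 <= S)%R by rewrite /S; lra.
apply: le_trans (F0 _ S1) _; apply: ereal_sup_ubound; exists S => //; exact: VM.
Qed.

Lemma limf_esup_le_cst (F : R -> \bar R) (c : R) :
  (forall S, (1 <= S)%R -> F S <= c%:E) ->
  limf_esup F (+oo%R : set_system R) <= c%:E.
Proof.
move=> Fc; rewrite limf_esupE.
apply: (@le_trans _ _ (ereal_sup (F @` [set S | 1 < S]%R))).
  by apply: ereal_inf_lbound; exists [set S | 1 < S]%R => //; exists 1%R.
by apply: ge_ereal_sup => _ [S /= S1 <-]; exact: Fc (ltW S1).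
Qed.

End limsup_bounds.

(** * The cost functional *)

Section cost_bounds.
Context {d : measure_display} {T : measurableType d} {R : realType}.
Variables (P : probability T R) (H : R).
Hypotheses (hH : 2^-1 <= H) (hH1 : H < 1).
Variable W : R -> {RV P >-> R}.
Hypothesis hW : fractional_brownian_motion H W.
Variables (p : R) (hp : 0 <= p).
Variable C : R -> R.
Hypothesis C_mono : {in `[0, +oo[ &, {homo C : y y' / y <= y'}}.
Variables (K gamma : R).
Hypotheses (hK : 0 < K) (hgamma : 0 < gamma).
Hypothesis C_growth : forall y : R, 0 <= y -> 0 <= C y <= K * (1 + y `^ gamma).
Variable u : R.
Hypothesis u0 : 0 < u.
Variable x : R.
Hypothesis x0 : 0 <= x.

Let cW w : {within `[0, +oo[, continuous (W ^~ w)}.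
Proof. exact: (fbm_continuous hW). Qed.

Let W0 w : W 0 w = 0.
Proof. exact: (fbm_start hW). Qed.

Let q := (Num.truncn gamma).+1.

Lemma C_ge0 y : 0 <= y -> 0 <= C y.
Proof. by move=> /C_growth /andP[]. Qed.

Lemma C_le_pow y : 0 <= y -> C y <= K * (2 + y ^+ q).
Proof.
move=> y0; have /andP[_ /le_trans] := C_growth y0; apply.
have yq : 0 <= y ^+ q by exact: exprn_ge0.
apply: ler_wpM2l; first exact: ltW.
have -> : 2 + y ^+ q = 1 + (1 + y ^+ q) by lra.
rewrite lerD2l; have [y1|y1] := leP y 1.
  apply: (@le_trans _ _ 1); last by rewrite lerDl.
  have := ge0_ler_powR (ltW hgamma) _ _ y1; rewrite !nnegrE powR1.
  by apply.
apply: (@le_trans _ _ (y ^+ q)); last by rewrite lerDr.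
rewrite -powR_mulrn//; apply: ler_powR; first exact: ltW.
by rewrite ltW// truncnS_gt.
Qed.

Lemma C_sqr_le_pow y : 0 <= y -> C y ^+ 2 <= K ^+ 2 * (8 + 2 * y ^+ q.*2).
Proof.
move=> y0; apply: (@le_trans _ _ ((K * (2 + y ^+ q)) ^+ 2)).
  have h := C_le_pow y0; have h0 := C_ge0 y0.
  by apply: lerXn2r; rewrite ?nnegrE// (le_trans h0).
rewrite exprMn; apply: ler_wpM2l; first exact: sqr_ge0.
rewrite -muln2 exprM; have := sqr_ge0 (2 - y ^+ q).
by set z := y ^+ q; rewrite !expr2; lra.
Qed.

(** Young's inequality with a free weight, which separates the event of being
uncoupled from the size of the running cost: the two are dependent. *)
Lemma C_le_weighted (l y : R) : 0 < l -> 0 <= y ->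
  C y <= l + l^-1 * (K ^+ 2 * (8 + 2 * y ^+ q.*2)).
Proof.
move=> l0 y0; have h := C_sqr_le_pow y0; have h0 := C_ge0 y0.
apply: (@le_trans _ _ (l + l^-1 * C y ^+ 2)); last first.
  by rewrite lerD2l; apply: ler_wpM2l => //; rewrite invr_ge0 ltW.
rewrite -(@ler_pM2l _ l)// mulrDr mulrA mulfV ?gt_eqF// mul1r.
by have := sqr_ge0 (l - C y); rewrite !expr2; nra.
Qed.

Lemma state_homo (t : R) w : 0 <= t -> state W 0 u t w <= state W x u t w.
Proof.
move=> t0; rewrite (stateE u (@cW w) (@W0 w) (lexx 0) t0).
rewrite (stateE u (@cW w) (@W0 w) x0 t0) lerD2l.
by case: (leP 0 (regulator W 0 u t w)); case: (leP x (regulator W 0 u t w));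
  have := x0; lra.
Qed.

Lemma state_coupled (n : nat) (t : R) w : ~ uncoupled W u (cst x) n w ->
  n%:R <= t -> state W x u t w = state W 0 u t w.
Proof.
rewrite /uncoupled/= => /negP; rewrite -leNgt => h nt.
have n0 : (0 : R) <= n%:R by [].
have t0 := le_trans n0 nt.
rewrite (stateE u (@cW w) (@W0 w) (lexx 0) t0).
rewrite (stateE u (@cW w) (@W0 w) x0 t0).
have L : x <= regulator W 0 u t w.
  apply: le_trans h _; apply: (@regulator0_ge _ _ _ W u w (@cW w)).
  by rewrite n0.
by rewrite !max_r// (le_trans x0).
Qed.

Lemma regulator_le_regulator0 (t : R) w : 0 <= t ->
  0 <= regulator W x u t w <= regulator W 0 u t w.
Proof.
move=> t0; have L0 := @regulator0_ge0 _ _ _ W u w (@cW w) (@W0 w) t t0.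
rewrite (regulatorE u (@cW w) (@W0 w) x0 t0) le_max lexx ge_max L0/= lerBlDr lerDl.
exact: x0.
Qed.

Definition running_cost (x' S : R) (w : T) : \bar R :=
  ((\int[lebesgue_measure]_(t in `[0%R, S]) (C (state W x' u t w))%:E)
   + (p * regulator W x' u S w)%:E)%E.

Lemma running_cost_ge0 (x' S : R) w : 0 <= x' -> 0 <= S ->
  (0 <= running_cost x' S w)%E.
Proof.
move=> x'0 S0; apply: adde_ge0.
  apply: integral_ge0 => t /=; rewrite in_itv/= => /andP[t0 _].
  by rewrite lee_fin C_ge0// (fbm_state_ge0 hW).
rewrite lee_fin mulr_ge0// (regulatorE u (@cW w) (@W0 w) x'0 S0).
by rewrite le_max lexx.
Qed.

Lemma expected_running_cost0_le (S : R) : 0 <= S ->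
  (\int[P]_w running_cost 0 S w <= \int[P]_w running_cost x S w + (p * x)%:E)%E.
Proof.
move=> S0; have px0 : 0 <= p * x by exact: mulr_ge0.
apply: (@le_trans _ _ (\int[P]_w (running_cost x S w + (p * x)%:E))%E).
  apply: ge0_le_lower_integralT => w; first exact: running_cost_ge0.
  rewrite /running_cost -[leRHS]addeA -EFinD; apply: leeD.
    apply: ge0_le_lower_integral => t /=; rewrite in_itv/= => /andP[t0 _].
      by rewrite lee_fin C_ge0// (fbm_state_ge0 hW).
    rewrite lee_fin; apply: C_mono; rewrite ?in_itv/= ?andbT.
    - exact: (fbm_state_ge0 hW).
    - exact: (fbm_state_ge0 hW).
    - exact: state_homo.
  rewrite lee_fin -mulrDr; apply: ler_wpM2l => //.
  rewrite (regulatorE u (@cW w) (@W0 w) x0 S0) -lerBlDr.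
  by rewrite le_max lexx orbT.
apply: le_trans (lower_integralD_le P _ _ _ _) _ => //.
- by move=> w _; exact: running_cost_ge0.
by rewrite integral_cst//= probability_setT mule1.
Qed.

(** The costs from x and from 0 differ only on unit intervals that are still
uncoupled at their left end n.  There [C_le_weighted] with weight (n + 1)^2
bounds the running cost by the indicator times (n + 1)^2 plus a variable with
bounded mean times (n + 1)^(-2); both are summable in n. *)
Lemma expected_running_cost_le0 : exists2 c : R, 0 <= c & forall S : R, 0 <= S ->
  (\int[P]_w running_cost x S w <= \int[P]_w running_cost 0 S w + c%:E)%E.
Proof.
have q0 : (0 < q.*2)%N by [].
have [m /andP[m0 qm] [cB cB0 hB]] := expectation_state_bound_le hH hH1 hW u0 x0 q0.
have mxi : measurable_fun setT (cst x : T -> R) by exact: measurable_cst.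
have [cU cU0 hU] := uncoupled_series_le hH hH1 hW u0 2 mxi (rapid_tail_cst P x0).
pose a n (w : T) : \bar R := (n.+1%:R ^+ 2 * \1_(uncoupled W u (cst x) n) w)%:E.
pose b n (w : T) : \bar R := ((n.+1%:R ^- 2 * K ^+ 2)%:E * (8%:E + 2%:E * state_bound W u x m q.*2 n w))%E.
have a0 n w : (0 <= a n w)%E by rewrite lee_fin mulr_ge0// exprn_ge0.
have k0 n : 0 <= n.+1%:R ^- 2 * K ^+ 2 by rewrite mulr_ge0 ?sqr_ge0// invr_ge0 exprn_ge0.
have B0 n w : (0 <= state_bound W u x m q.*2 n w)%E by exact: state_bound_ge0.
have b0 n w : (0 <= b n w)%E.
  by apply: mule_ge0; [rewrite lee_fin|apply: adde_ge0 => //; exact: mule_ge0].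
have mB n : measurable_fun setT (state_bound W u x m q.*2 n) by exact: measurable_state_bound.
have ma n : measurable_fun setT (a n).
  apply/measurable_EFinP; apply: measurable_funM => //.
  by apply: measurable_indic; exact: measurable_uncoupled.
have mb n : measurable_fun setT (b n).
  by apply: emeasurable_funM => //; apply: emeasurable_funD => //; exact: emeasurable_funM.
pose G w := (\sum_(n <oo) (a n w + b n w))%E.
have G0 w : (0 <= G w)%E by apply: nneseries_ge0 => n _ _; exact: adde_ge0.
have mG : measurable_fun setT G.
  apply: ge0_emeasurable_sum => [n w _ _|n _]; first exact: adde_ge0.
  exact: emeasurable_funD.
have EG : (\int[P]_w G w <= (cU + K ^+ 2 * (8 + 2 * cB) * 2)%:E)%E.
  have -> : G = (fun w => (\sum_(n <oo) a n w) + (\sum_(n <oo) b n w))%E.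
    by apply/funext => w; rewrite /G nneseriesD.
  rewrite ge0_integralD//; last 4 first.
  - by move=> w _; apply: nneseries_ge0 => n _ _.
  - by apply: ge0_emeasurable_sum.
  - by move=> w _; apply: nneseries_ge0 => n _ _.
  - by apply: ge0_emeasurable_sum.
  rewrite EFinD; apply: leeD; first by rewrite /a uncoupled_integral_series.
  rewrite integral_nneseries//; apply: nneseries_le_bound => [n|N].
    by apply: integral_ge0 => w _.
  apply: (@le_trans _ _ (\sum_(0 <= n < N) (K ^+ 2 * (8 + 2 * cB) * n.+1%:R ^- 2)%:E)%E).
    apply: lee_sum => n _; rewrite ge0_integralZl//; last 3 first.
    - by apply: emeasurable_funD => //; exact: emeasurable_funM.
    - by move=> w _; apply: adde_ge0 => //; exact: mule_ge0.
    - by rewrite lee_fin.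
    rewrite ge0_integralD//; last 2 first.
    - by move=> w _; exact: mule_ge0.
    - exact: emeasurable_funM.
    rewrite integral_cst//= probability_setT mule1 ge0_integralZl//.
    have -> : K ^+ 2 * (8 + 2 * cB) * n.+1%:R ^- 2 =
      (n.+1%:R ^- 2 * K ^+ 2) * (8 + 2 * cB) by ring.
    rewrite [leRHS]EFinM; apply: lee_wpmul2l; first by rewrite lee_fin.
    rewrite [(8 + _)%:E]EFinD; apply: leeD => //; rewrite [(2 * _)%:E]EFinM; apply: lee_wpmul2l => //; exact: hB.
  rewrite sumEFin lee_fin -mulr_sumr ler_wpM2l ?sum_inv_sqr_le//.
  by rewrite mulr_ge0 ?sqr_ge0// addr_ge0// mulr_ge0.
exists (cU + K ^+ 2 * (8 + 2 * cB) * 2) => [|S S0].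
  by rewrite addr_ge0// mulr_ge0// mulr_ge0 ?sqr_ge0// addr_ge0// mulr_ge0.
apply: (@le_trans _ _ (\int[P]_w (running_cost 0 S w + G w))%E); last first.
  apply: le_trans (lower_integralD_le P _ _ _ mG) _ => //.
    by move=> w _; exact: running_cost_ge0.
  exact: leeD.
apply: ge0_le_lower_integralT => w; first exact: running_cost_ge0.
rewrite /running_cost [leRHS]addeAC; apply: leeD; last first.
  by rewrite lee_fin; apply: ler_wpM2l => //; case/andP: (regulator_le_regulator0 w S0).
apply: integral_le_step => [n|t /andP[t0 _]|t /andP[t0 _]|t /andP[t0 _]].
- exact: adde_ge0.
- by rewrite lee_fin C_ge0// (fbm_state_ge0 hW).
- by rewrite lee_fin C_ge0// (fbm_state_ge0 hW).
have nt := truncn_itv t0; set n := Num.truncn t in nt *.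
have /andP[nt1 _] := nt.
have Cx0 : 0 <= C (state W 0 u t w) by rewrite C_ge0// (fbm_state_ge0 hW).
have [hn|hn] := pselect (uncoupled W u (cst x) n w); last first.
  by rewrite (state_coupled hn nt1) leeDl// adde_ge0.
apply: (@le_trans _ _ (a n w + b n w)%E); last by rewrite leeDr// lee_fin.
have s0 : 0 <= state W x u t w by exact: (fbm_state_ge0 hW).
have l0 : 0 < (n.+1%:R : R) ^+ 2 by rewrite exprn_gt0.
apply: le_trans (_ : (_ <= (n.+1%:R ^+ 2 + n.+1%:R ^- 2 * (K ^+ 2 * (8 + 2 * state W x u t w ^+ q.*2)))%:E)%E) _.
  by rewrite lee_fin; exact: C_le_weighted.
rewrite EFinD; apply: leeD; first by rewrite /a indicE mem_set// mulr1.
rewrite mulrA EFinM; apply: lee_wpmul2l; first by rewrite lee_fin.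
rewrite [(8 + _)%:E]EFinD; apply: leeD => //; rewrite [(2 * _)%:E]EFinM; apply: lee_wpmul2l => //.
exact: (@state_pow_le_bound _ _ _ P H W hW u x u0 x0 m q.*2 n t w m0).
Qed.

(** The regulator at S is at most the state plus uS - W(S), and
-W(S) <= S + W(S)^2 / S has mean at most 2S because the variance S^(2H) is at
most S^2. *)
Lemma expected_running_cost_linear : exists2 c : R, 0 <= c & forall S : R, 1 <= S ->
  (\int[P]_w running_cost x S w <= (c * S)%:E)%E.
Proof.
have q0 : (0 < q)%N by [].
have [m /andP[m0 qm] [cB cB0 hB]] := expectation_state_bound_le hH hH1 hW u0 x0 q0.
have B0 n w : (0 <= state_bound W u x m q n w)%E by exact: state_bound_ge0.
have mB n : measurable_fun setT (state_bound W u x m q n) by exact: measurable_state_bound.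
exists (2 * (K * (2 + cB)) + p * (3 + u + cB)) => [|S S1].
  have := ltW hK; have := ltW u0; have := hp => h1 h2 h3.
  by rewrite addr_ge0 ?mulr_ge0 ?addr_ge0.
have S0 : 0 < S by exact: lt_le_trans S1.
have S0' := ltW S0.
pose N := Num.truncn S.
pose a n (w : T) : \bar R := (K%:E * (2%:E + state_bound W u x m q n w))%E.
pose a' n (w : T) : \bar R := if (n < N.+1)%N then a n w else 0%E.
pose r w : \bar R := ((1 + u * S + S)%:E + state_bound W u x m q N w + (W S w ^+ 2 / S)%:E)%E.
have a0 n w : (0 <= a n w)%E.
  by apply: mule_ge0; [rewrite lee_fin ltW|apply: adde_ge0].
have ma n : measurable_fun setT (a n).
  by apply: emeasurable_funM => //; exact: emeasurable_funD.
have a'0 n w : (0 <= a' n w)%E by rewrite /a'; case: ifP.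
have uS0 : 0 <= 1 + u * S + S by rewrite !addr_ge0// mulr_ge0// ltW.
have WS0 w : 0 <= W S w ^+ 2 / S by rewrite mulr_ge0 ?sqr_ge0// invr_ge0.
have r0 w : (0 <= r w)%E by rewrite !adde_ge0// lee_fin.
have mWS : measurable_fun setT (fun w => (W S w ^+ 2 / S)%:E).
  by apply/measurable_EFinP; apply: measurable_funM => //; exact: measurable_funX.
have mr : measurable_fun setT r.
  by apply: emeasurable_funD => //; exact: emeasurable_funD.
pose A w : \bar R := (\sum_(0 <= n < N.+1) a n w)%E.
have A0 w : (0 <= A w)%E by exact: sume_ge0.
have mA : measurable_fun setT A by exact: emeasurable_sum.
apply: (@le_trans _ _ (\int[P]_w (A w + p%:E * r w))%E).
  apply: ge0_le_lower_integralT => w; first exact: running_cost_ge0.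
  rewrite /running_cost; apply: leeD; last first.
    apply: (@le_trans _ _ (p%:E * (1 + u * S + S + state W x u S w ^+ q + W S w ^+ 2 / S)%:E)%E).
      rewrite -EFinM lee_fin; apply: ler_wpM2l => //.
      have /andP[_ h1] := regulator_le_regulator0 w S0'.
      have h2 : W S w - u * S + regulator W 0 u S w <= state W x u S w.
        by rewrite (stateE u (@cW w) (@W0 w) x0 S0') lerD2l le_max lexx orbT.
      have h3 : state W x u S w <= 1 + state W x u S w ^+ q.
        by rewrite -[leLHS]expr1; apply: expr_le_1D => //; exact: (fbm_state_ge0 hW).
      have h4 : - W S w <= S + W S w ^+ 2 / S.
        rewrite -(@ler_pM2r _ S)// mulrDl divfK ?gt_eqF// -expr2.
        by have := sqr_ge0 (W S w + S); rewrite !expr2; have := mulr_ge0 S0' S0'; nra.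
      by lra.
    apply: lee_wpmul2l; first by rewrite lee_fin.
    rewrite /r EFinD; apply: leeD => //; rewrite EFinD; apply: leeD => //.
    apply: (@state_pow_le_bound _ _ _ P H W hW u x u0 x0 m q N S w m0) => //.
    exact: truncn_itv.
  apply: (@le_trans _ _ (\int[lebesgue_measure]_(t in `[0%R, S]) 0 + \sum_(n <oo) a' n w)%E).
    apply: integral_le_step => [//|t /andP[t0 _]|t _|t /andP[t0 tS]] //.
      by rewrite lee_fin C_ge0// (fbm_state_ge0 hW).
    rewrite add0e /a' ltnS (_ : (Num.truncn t <= N)%N); last exact: le_truncn.
    apply: le_trans (_ : (_ <= (K * (2 + state W x u t w ^+ q))%:E)%E) _.
      by rewrite lee_fin; apply: C_le_pow; exact: (fbm_state_ge0 hW).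
    rewrite EFinM; apply: lee_wpmul2l; first by rewrite lee_fin ltW.
    rewrite [(2 + _)%:E]EFinD; apply: leeD => //.
    by apply: (@state_pow_le_bound _ _ _ P H W hW u x u0 x0 m q _ t w m0) => //; exact: truncn_itv.
  rewrite integral0 add0e; apply: nneseries_le_bound => // n.
  rewrite /A (big_nat_widen _ _ (maxn n N.+1)) ?leq_maxl//.
  rewrite [leRHS](big_nat_widen _ _ (maxn n N.+1)) ?leq_maxr//.
  rewrite big_mkcond [leRHS]big_mkcond/=; apply: lee_sum => i _.
  by rewrite /a'; do 2 case: ifP.
rewrite ge0_integralD//; first last.
- exact: emeasurable_funM.
- by move=> w _; exact: mule_ge0.
rewrite mulrDl EFinD; apply: leeD.
  rewrite ge0_integral_sum//.
  apply: (@le_trans _ _ (\sum_(0 <= n < N.+1) (K * (2 + cB))%:E)%E).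
    apply: lee_sum => n _; rewrite ge0_integralZl//; last 3 first.
    - exact: emeasurable_funD.
    - by move=> w _; exact: adde_ge0.
    - by rewrite lee_fin ltW.
    rewrite EFinM; apply: lee_wpmul2l; first by rewrite lee_fin ltW.
    rewrite ge0_integralD// integral_cst//= probability_setT mule1.
    rewrite [(2 + _)%:E]EFinD; apply: leeD => //.
  rewrite sumEFin lee_fin sumr_const_nat subn0 -[leLHS]mulr_natr.
  have NS : N.+1%:R <= 2 * S.
    have /andP[h _] := truncn_itv S0'; rewrite -/N in h.
    by rewrite -natr1; lra.
  rewrite [2 * _]mulrC -[leRHS]mulrA; apply: ler_wpM2l => //.
  by rewrite mulr_ge0 ?addr_ge0// ltW.
rewrite ge0_integralZl//.
rewrite -mulrA EFinM; apply: lee_wpmul2l; first by rewrite lee_fin.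
rewrite ge0_integralD//; last 3 first.
- by move=> w _; apply: adde_ge0 => //; rewrite lee_fin.
- exact: emeasurable_funD.
- by move=> w _; rewrite lee_fin.
rewrite ge0_integralD// integral_cst//= probability_setT mule1.
have EW : (\int[P]_w (W S w ^+ 2 / S)%:E <= S%:E)%E.
  under eq_integral do rewrite EFinM.
  rewrite ge0_integralZr//; last 3 first.
  - by apply/measurable_EFinP; exact: measurable_funX.
  - by move=> w _; rewrite lee_fin sqr_ge0.
  - by rewrite lee_fin invr_ge0.
  rewrite (fbm_second_moment hH hW S0') -EFinM lee_fin ler_pdivrMr// -expr2.
  apply: lerXn2r; rewrite ?nnegrE ?powR_ge0//.
  by apply: ler1_powR => //; exact: ltW.
apply: le_trans (leeD (leeD (lexx _) (hB N)) EW) _.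
rewrite -!EFinD lee_fin.
by have := cB0; nra.
Qed.

End cost_bounds.

Section cost_functional.
Context {d : measure_display} {T : measurableType d} {R : realType}.
Variables (P : probability T R) (H : R).
Hypotheses (hH : 2^-1 <= H) (hH1 : H < 1).
Variable W : R -> {RV P >-> R}.
Hypothesis hW : fractional_brownian_motion H W.
Variables (p : R) (hp : 0 <= p).
Variables h C : R -> R.
Hypothesis h_ge0 : forall v : R, 0 <= v -> 0 <= h v.
Hypothesis C_mono : {in `[0, +oo[ &, {homo C : y y' / y <= y'}}.
Variables (K gamma : R).
Hypotheses (hK : 0 < K) (hgamma : 0 < gamma).
Hypothesis C_growth : forall y : R, 0 <= y -> 0 <= C y <= K * (1 + y `^ gamma).

Section fixed_drift.
Variable u : R.
Hypothesis u0 : 0 < u.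

Let average (x S : R) : \bar R :=
  ((S^-1)%:E * \int[P]_w running_cost W p C u x S w)%E.

Let costE x : cost P W h C p u x =
  ((h u)%:E + limf_esup (average x) (+oo%R : set_system R))%E.
Proof. by []. Qed.

Let average_ge0 x S : 0 <= x -> 1 <= S -> (0 <= average x S)%E.
Proof.
move=> x0 S1; have S0 : 0 <= S by exact: le_trans S1.
apply: mule_ge0; first by rewrite lee_fin invr_ge0.
by apply: integral_ge0 => w _; exact: (running_cost_ge0 hW hp C_growth).
Qed.

Let average_le x y c : 0 <= c ->
  (forall S, 0 <= S -> (\int[P]_w running_cost W p C u x S w <=
    \int[P]_w running_cost W p C u y S w + c%:E)%E) ->
  (limf_esup (average x) (+oo%R : set_system R) <=
   limf_esup (average y) (+oo%R : set_system R))%E.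
Proof.
move=> c0 hc; apply: (limf_esup_le_shift c0) => S S1.
have S0 : 0 < S by exact: lt_le_trans S1.
rewrite [c / S]mulrC EFinM.
rewrite /average; set I := (\int[P]_w running_cost W p C u y S w)%E.
apply: le_trans (lee_wpmul2l _ (hc S (ltW S0))) _.
  by rewrite lee_fin invr_ge0 ltW.
by rewrite muleDr// fin_num_adde_defl.
Qed.

Lemma cost_ge0 x : 0 <= x -> (0 <= cost P W h C p u x)%E.
Proof.
move=> x0; rewrite costE; apply: adde_ge0; first by rewrite lee_fin h_ge0// ltW.
by apply: limf_esup_ge0 => S S1; exact: average_ge0.
Qed.

Lemma cost_fin_num x : 0 <= x -> cost P W h C p u x \is a fin_num.
Proof.
move=> x0; rewrite ge0_fin_numE ?cost_ge0//.
have [c c0 hc] := expected_running_cost_linear hH hH1 hW hp hK hgamma C_growth u0 x0.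
rewrite costE; apply: (@le_lt_trans _ _ ((h u)%:E + c%:E)%E); last by rewrite -EFinD ltry.
apply: leeD => //; apply: limf_esup_le_cst => S S1.
have S0 : 0 < S by exact: lt_le_trans S1.
apply: le_trans (lee_wpmul2l _ (hc S S1)) _; first by rewrite lee_fin invr_ge0 ltW.
by rewrite -EFinM lee_fin mulrCA mulVf ?mulr1// gt_eqF.
Qed.

Lemma cost_independent x : 0 <= x -> cost P W h C p u x = cost P W h C p u 0.
Proof.
move=> x0; suff e : limf_esup (average x) (+oo%R : set_system R) =
    limf_esup (average 0) (+oo%R : set_system R) by rewrite (costE x) (costE 0) e.
have [c c0 hc] := expected_running_cost_le0 hH hH1 hW hp hK hgamma C_growth u0 x0.
have px0 : 0 <= p * x by exact: mulr_ge0.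
apply: le_anti; apply/andP; split; first exact: (average_le c0 hc).
by apply: (average_le px0) => S; exact: (expected_running_cost0_le hW hp C_mono C_growth).
Qed.

End fixed_drift.

Lemma value_fin_num x : 0 <= x -> value P W h C p x \is a fin_num.
Proof.
move=> x0; rewrite ge0_fin_numE; last first.
  apply: le_ereal_inf_tmp => _ [v /= + <-]; rewrite in_itv/= andbT => v0.
  exact: cost_ge0.
have := cost_fin_num ltr01 x0; rewrite ge0_fin_numE ?cost_ge0//.
apply: le_lt_trans; apply: ereal_inf_lbound; exists 1 => //.
by rewrite /= in_itv/= ltr01.
Qed.

Let value_le x y : 0 <= x -> 0 <= y -> (value P W h C p x <= value P W h C p y)%E.
Proof.
move=> x0 y0; apply: le_ereal_inf_tmp => _ [v vpos <-].
have v0 : 0 < v by move: vpos; rewrite /= in_itv/= andbT.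
apply: ereal_inf_lbound; exists v; first exact: vpos.
by rewrite (cost_independent v0 x0) (cost_independent v0 y0).
Qed.

Lemma value_independent x : 0 <= x -> value P W h C p x = value P W h C p 0.
Proof.
move=> x0; apply: le_anti; apply/andP; split.
  exact: value_le x0 (lexx 0).
exact: value_le (lexx 0) x0.
Qed.

End cost_functional.

Theorem proposition3p2 (R : realType) (d : measure_display)
    (T : measurableType d) (P : probability T R)
    (H : R) (hH : 2^-1 <= H) (hH1 : H < 1)
    (W : R -> {RV P >-> R}) (hW : fractional_brownian_motion H W)
    (p : R) (hp : 0 <= p)
    (h : R -> R)
    (h_ge0 : forall v : R, 0 <= v -> 0 <= h v)
    (h_cont : {within `[0, +oo[, continuous h})
    (h_mono : {in `[0, +oo[ &, {homo h : v v' / v <= v'}})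
    (h_infty : h v @[v --> +oo] --> +oo)
    (C : R -> R)
    (C_cont : {within `[0, +oo[, continuous C})
    (C_mono : {in `[0, +oo[ &, {homo C : y y' / y <= y'}})
    (K gamma : R) (hK : 0 < K) (hgamma : 0 < gamma)
    (C_growth : forall y : R, 0 <= y -> 0 <= C y <= K * (1 + y `^ gamma))
    (u : R) (hu : 0 < u)
    (Xs : R -> {RV P >-> R})
    (Xs_stationary : stationary_process P Xs)
    (Xs_dynamics : forall (t : R) (w : T), 0 <= t ->
      Xs t w = W t w - u * t + Num.max (Xs 0 w) (regulator W 0 u t w))
    (Xs_law : forall t : R, 0 <= t ->
      same_law P (fun w => (Xs t w)%:E) (all_time_max W u))
    (x : R) (hx : 0 <= x) :
  (exists tau : T -> \bar R,
    [/\ stopping_time (generated_filtration (state W x u) Xs) tau,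
        {ae P, forall w, (tau w < +oo)%E},
        forall (w : T) (t : R), 0 <= t -> (tau w <= t%:E)%E -> state W x u t w = Xs t w &
        forall beta : R, 0 <= beta -> (\int[P]_w (tau w `^ beta) < +oo)%E])
  /\
  (cost P W h C p u x \is a fin_num /\ cost P W h C p u x = cost P W h C p u 0)
  /\
  (value P W h C p x \is a fin_num /\ value P W h C p x = value P W h C p 0).
Proof.
have tail0 := stationary_rapid_tail hH hH1 hW hu Xs_dynamics Xs_law.
split; last first.
  split; split.
  - exact: (cost_fin_num hH hH1 hW hp h_ge0 hK hgamma C_growth hu hx).
  - exact: (cost_independent hH hH1 hW hp h C_mono hK hgamma C_growth hu hx).
  - exact: (value_fin_num hH hH1 hW hp h_ge0 hK hgamma C_growth hx).
  - exact: (value_independent hH hH1 hW hp h C_mono hK hgamma C_growth hx).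
exists (coupling_time W u Xs x); split.
- exact: (coupling_time_stopping hW Xs_dynamics hx).
- exact: (coupling_time_finite hH hH1 hW hu Xs_dynamics hx tail0).
- move=> w t t0 /(coupling_time_leP hW Xs_dynamics hx w t0) h'.
  have /andP[tt _] := truncn_itv t0.
  exact: (coupled_homo hW Xs_dynamics hx _ tt h').
- exact: (coupling_time_moment hH hH1 hW hu Xs_dynamics hx tail0).
Qed.
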